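(* Let $H$ be a graph with vertex set $\{1,\dots,k\}$. For every subgraph $H' \subseteq H$ and every $d > 0$, there exist $\epsilon, \xi, b, C > 0$ and an integer $n_0$ such that if $n \geq n_0$ and $p \geq C n^{-1/m_2(H)}$, then the following holds. For every $G \in \mathcal{G}_\ell(H,n,d,\epsilon)$, with probability at least $1 - \exp(-b p n^2)$ the random graph $G_p$ has the property that every subgraph $G'$ of $G_p$ with $G' \in \mathcal{G}_\ell(H,n,dp,\epsilon)$ (with respect to the same sets $V_1,\dots,V_k$ as $G$) satisfies \[ |\mathcal{C}(H,G;H',G')| \geq \xi p^{e(H')} n^{v(H)}. \]
   Context: A bipartite graph between sets $U$ and $V$ is $(\epsilon,d)$-lower-regular if for every $U' \subseteq U$, $V'\subseteq V$ with $|U'| \geq \epsilon|U|$ and $|V'| \geq \epsilon|V|$, the density $e(U',V')/(|U'||V'|)$ is at least $d$. For a graph $H$ on vertex set $\{1,\dots,k\}$, $\mathcal{G}_\ell(H,n,d,\epsilon)$ is the collection of graphs on vertex set $V_1 \cup \dots \cup V_k$ (pairwise disjoint sets of size $n$) whose edge set consists of, for each $ij \in E(H)$, an $(\epsilon,d)$-lower-regular bipartite graph between $V_i$ and $V_j$ (and no other edges). For a graph $G$ and $p \in [0,1]$, $G_p$ is the random subgraph of $G$ obtained by keeping each edge independently with probability $p$. A canonical copy of $H$ in $G$ is a $k$-tuple $(v_1,\dots,v_k)\in V_1\times\dots\times V_k$ with $v_iv_j \in E(G)$ for all $ij \in E(H)$. For $H' \subseteq H$ and graphs $G, G'$ on $V_1\cup\dots\cup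 V_k$, $\mathcal{C}(H,G;H',G')$ is the set of canonical copies $(v_1,\dots,v_k)$ of $H$ in $G$ such that $v_iv_j \in E(G')$ for every $ij \in E(H')$. The $2$-density is $m_2(H) = \max\{ (e(H'')-1)/(v(H'')-2) : H'' \subseteq H,\ v(H'') \geq 3\}$, with $m_2(K_2)=1/2$. *)

(* Defs.v *)
From mathcomp Require Import all_boot all_order all_algebra.
From mathcomp Require Import all_classical all_reals all_analysis.

Set Implicit Arguments.
Unset Strict Implicit.
Unset Printing Implicit Defensive.

Import Order.TTheory GRing.Theory Num.Theory.
Local Open Scope ring_scope.

(* A graph on the finite vertex type [V], given by its edge set. *)
Notation graph V := {set {set V}}.

Definition is_graph (V : finType) (E : graph V) : bool :=
  [forall e in E, #|e| == 2%N].

Definition adj (V : finType) (E : graph V) (x y : V) : bool :=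
  [set x; y] \in E.

(* A subgraph consists of a vertex set [W] and edges [F] contained in [W]. *)
Definition is_subgraph (V : finType) (W : {set V}) (F E : graph V) : bool :=
  (F \subset E) && [forall e in F, e \subset W].

(* For at least three vertices the set below is finite and nonempty, so that
   its supremum is a maximum.  For an edgeless graph on at most two vertices
   the 2-density is not defined in the literature; here it is [sup set0 = 0]. *)
Definition m2 (R : realType) (V : finType) (E : graph V) : R :=
  if (#|V| == 2%N) && (#|E| == 1%N) then 2%:R^-1
  else sup [set q : R | exists (W : {set V}) (F : graph V),
         [/\ is_subgraph W F E, (3 <= #|W|)%N
           & q = (#|F|%:R - 1) / (#|W|%:R - 2%:R)]]%classic.

(* n^(-1/m2(E)).  When [m2 E = 0] (for instance for one edge plus isolated
   vertices) the exponent is read as -oo and the value is 0, so that no lower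
   bound is imposed on the edge probability. *)
Definition threshold (R : realType) (V : finType) (E : graph V) (n : nat) : R :=
  if m2 R E == 0 then 0 else n%:R `^ (- (1 / m2 R E)).

Section LowerRegular.
Variables (R : realType) (V : finType).

(* Number of edges between [A] and [B], for disjoint [A] and [B]. *)
Definition edges_between (E : graph V) (A B : {set V}) : nat :=
  #|[set x : V * V | [&& x.1 \in A, x.2 \in B & adj E x.1 x.2]]|.

Definition density (E : graph V) (A B : {set V}) : R :=
  (edges_between E A B)%:R / (#|A|%:R * #|B|%:R).

Definition lower_regular (eps d : R) (E : graph V) (A B : {set V}) : bool :=
  [forall A' : {set V}, forall B' : {set V},
    [&& A' \subset A, B' \subset B,
        eps * #|A|%:R <= #|A'|%:R & eps * #|B|%:R <= #|B'|%:R]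
    ==> (d <= density E A' B')].

End LowerRegular.

(* The vertex set V_1 u ... u V_k, with V_i = {i} x {0, ..., n-1}. *)
Notation vertex k n := ('I_k * 'I_n)%type.

Definition part (k n : nat) (i : 'I_k) : {set vertex k n} :=
  [set x | x.1 == i].

(* The class G_l(H, n, d, eps). *)
Definition Gl (R : realType) (k : nat) (H : graph 'I_k) (n : nat) (d eps : R)
    (G : graph (vertex k n)) : bool :=
  [&& is_graph G,
      [forall x, forall y, adj G x y ==> adj H x.1 y.1]
    & [forall i, forall j,
        adj H i j ==> lower_regular eps d G (part n i) (part n j)]].

(* The set C(H, G; H', G'). *)
Definition canonical_copies (k n : nat) (H : graph 'I_k)
    (G : graph (vertex k n)) (H' : graph 'I_k) (G' : graph (vertex k n)) :
    {set {ffun 'I_k -> vertex k n}} :=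
  [set v : {ffun 'I_k -> vertex k n} |
    [&& [forall i, v i \in part n i],
        [forall i, forall j, adj H i j ==> adj G (v i) (v j)]
      & [forall i, forall j, adj H' i j ==> adj G' (v i) (v j)]]].

(* The probability that [G_p] satisfies [A]; the edges of [G] are kept
   independently, whence the product weights. *)
Definition prob_Gp (R : realType) (V : finType) (G : graph V) (p : R)
    (A : pred (graph V)) : R :=
  \sum_(F in powerset G | A F) \prod_(e in G) (if e \in F then p else 1 - p).

(* Main.v *)
(* Containers.  From the hypergraph of canonical copies of [H] in [G], whose hyperedges record the
   edges used by [H'], an online algorithm extracts from any graph [I] with few copies a small
   fingerprint [S] included in [I] which determines a container including [I] with fewer than
   [xi n^k] copies.  The bound on [p] is exactly the codegree condition needed to bound [S] by
   a small multiple of [p n^2].  By the counting lemma for dense lower-regular graphs, a container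
   has a pair [(A, B)] of large sets of density below [d / 4], in which a lower-regular subgraph
   of [G_p] included in the container has density at least [d p].  For a given [S] this deviation
   has probability [exp(- c p n^2)], so that a union bound over the fingerprints concludes. *)
Require Import Defs.
From mathcomp Require Import all_boot all_order all_algebra.
From mathcomp Require Import all_classical all_reals all_analysis.
From mathcomp Require Import ring lra.
From mathcomp Require Import fintype finset.
Import Order.TTheory GRing.Theory Num.Theory.
Local Open Scope ring_scope.

Set Implicit Arguments.
Unset Strict Implicit.
Unset Printing Implicit Defensive.

(** * Container algorithm *)

(** Why a container is found: a pass trades one position of the hyperedges for a factor [q] in the
    scale [u]. If every pass kept many hyperedges, those left at the end would have all their
    positions in [I] and number at least a constant times [u * q ^+ s.+1 * N], against the
    assumption of few copies. So some pass keeps little; as it starts from many hyperedges with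
    bounded codegrees, many heavy elements must lie outside [I], and these are cut off from the
    container. The obstacle is the size of the fingerprint: choosing [S] must cost less than the
    deviation gains, so [#|S|] has to be a small multiple of [p * n ^ 2]. Hence the codegree
    condition is used at [q = delta * p] instead of [p], which costs only [delta^-1] in [C] and
    [delta ^+ #|H'|] in [xi]. There is no circularity: the container constants [L] and [c0] depend
    on [k], [d] and [#|H'|] alone, and [delta] is chosen after them. *)

Lemma card_fibres (X V : finType) (f : X -> V) (A : {set X}) (B : {set V}) :
  {in A, forall x, f x \in B} -> #|A| = (\sum_(v in B) #|[set x in A | f x == v]|)%N.
Proof.
move=> AB; rewrite -sum1_card (partition_big f (mem B)) //=.
by apply: eq_bigr => v _; rewrite -sum1dep_card.
Qed.

Lemma card_fibres_le (R : realType) (X V : finType) (f : X -> V) (A : {set X})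
    (B : {set V}) (t : R) :
  {in A, forall x, f x \in B} ->
  {in B, forall v, #|[set x in A | f x == v]|%:R <= t} -> #|A|%:R <= #|B|%:R * t.
Proof.
move=> AB h; rewrite (card_fibres AB) natr_sum (le_trans (ler_sum _ h))//.
by rewrite sumr_const mulr_natl.
Qed.

(** * Codegrees in a hypergraph with labelled positions *)

Section Degree.
Context {X V J : finType} (phi : J -> X -> V).

Definition agree (T : {set J}) (x y : X) : bool :=
  [forall e in T, phi e x == phi e y].

(** The codegree of the tuple that [x] shows at the positions [T]; naming the tuple by a hyperedge
    avoids tuples indexed by a varying set [T]. *)
Definition degree (F : {set X}) (T : {set J}) (x : X) : nat :=
  #|[set y in F | agree T x y]|.

Lemma agreeP (T : {set J}) (x y : X) :
  reflect (forall e, e \in T -> phi e x = phi e y) (agree T x y).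
Proof. by apply: (iffP forall_inP) => h e /h /eqP. Qed.

Lemma agree_sym (T : {set J}) (x y : X) : agree T x y = agree T y x.
Proof. by apply/agreeP/agreeP => h e /h. Qed.

Lemma degree_sub (F F' : {set X}) (T : {set J}) (x : X) :
  F \subset F' -> (degree F T x <= degree F' T x)%N.
Proof.
move=> sFF; apply/subset_leq_card/subsetP => y; rewrite !inE => /andP[yF ->].
by rewrite (subsetP sFF).
Qed.

Lemma degree_agree (F : {set X}) (T : {set J}) (x y : X) :
  agree T x y -> degree F T x = degree F T y.
Proof.
move=> /agreeP xy; apply: eq_card => z; rewrite !inE; congr (_ && _).
by apply/agreeP/agreeP => h e eT; rewrite -(h e eT) (xy e eT).
Qed.

Lemma sum_degree_sym (F F' : {set X}) (T : {set J}) :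
  (\sum_(x in F) degree F' T x = \sum_(y in F') degree F T y)%N.
Proof.
under eq_bigr do rewrite /degree -sum1dep_card.
rewrite (exchange_big_dep (mem F')) /=; last by move=> x y _ /andP[].
apply: eq_bigr => y yF'; rewrite /degree -sum1dep_card.
by apply: eq_bigl => x; rewrite yF' agree_sym.
Qed.

End Degree.

(** * Functions of a set that are determined by a small subset of it *)

Section Certificates.
Context {R : realType} {V : finType}.

(** The value can be read off [S], by taking [J := S]. Asking for every set between [S] and [I]
    makes certificates composable: the union of two of them lies between each one and [I]. *)
Definition certified {T : Type} (f : {set V} -> T) (I : {set V}) (m : R) : Prop :=
  exists S : {set V}, [/\ S \subset I, #|S|%:R <= m &
    forall J : {set V}, S \subset J -> J \subset I -> f J = f I].

Lemma certified_const (T : Type) (a : T) (I : {set V}) (m : R) :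
  0 <= m -> certified (fun=> a) I m.
Proof. by move=> m0; exists set0; rewrite cards0 sub0set. Qed.

Lemma certified_dep (T U : Type) (f : {set V} -> T) (g : T -> {set V} -> U)
    (I : {set V}) (m m' : R) :
  certified f I m -> certified (g (f I)) I m' ->
  certified (fun J => g (f J) J) I (m + m').
Proof.
move=> [S [SI cS hS]] [S' [SI' cS' hS']]; exists (S :|: S'); split.
- by rewrite subUset SI.
- rewrite (le_trans _ (lerD cS cS'))// -natrD ler_nat.
  by rewrite (leq_trans (leq_card_setU S S')).
by move=> J; rewrite subUset => /andP[SJ SJ'] JI; rewrite hS// hS'.
Qed.

End Certificates.

(* The order of examination is fixed in advance and does not depend on [I]: this is why the pass
   is determined by the elements of [I] that it records.  The caps in [unsaturated] keep the
   codegrees of the family of kept hyperedges, seen without position [j], a factor [q] below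
   those of [F]. *)
Section Pass.
Context {R : realType} {X V J : finType} (phi : J -> X -> V).
Variables (F : {set X}) (P : {set J}) (j : J) (u q tau : R).

Definition unsaturated (Q : {set X}) (x : X) : bool :=
  [forall T : {set J}, (T \subset P) && (T != set0) ==>
     ((degree phi Q T x)%:R < u * q ^+ #|T|.+1)].

Definition fresh (Q : {set X}) (v : V) : {set X} :=
  [set x in F | (phi j x == v) && unsaturated Q x].

(** The second component collects every heavy element met, in [I] or not: those in [I] will form the
    fingerprint, those outside [I] can be removed from the container. *)
Definition pass_step (I : {set V}) (st : {set X} * {set V}) (v : V) :=
  if tau <= #|fresh st.1 v|%:R then
    (if v \in I then st.1 :|: fresh st.1 v else st.1, v |: st.2)
  else st.

Definition pass (I : {set V}) := foldl (pass_step I).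

Lemma unsaturated_sub (Q Q' : {set X}) (x : X) :
  Q \subset Q' -> unsaturated Q' x -> unsaturated Q x.
Proof.
move=> QQ /forallP h; apply/forallP => T; apply/implyP => /(implyP (h T)).
by apply: le_lt_trans; rewrite ler_nat degree_sub.
Qed.

Lemma pass_sub (I : {set V}) (st : {set X} * {set V}) (s : seq V) : st.2 \subset (pass I st s).2.
Proof.
elim: s st => [|v s IH] st //=; apply: subset_trans (IH _).
by rewrite /pass_step; case: ifP => //= _; exact: subsetUr.
Qed.

(** Membership in [I] is only queried for elements that enter the second component, so two sets that
    agree there lead to the same run. *)
Lemma pass_certificate (I I' : {set V}) (st : {set X} * {set V}) (s : seq V) :
  (pass I st s).2 :&: I \subset I' -> I' \subset I -> pass I' st s = pass I st s.
Proof.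
move=> + I'I; elim: s st => [|v s IH] st //= h.
suff E : pass_step I' st v = pass_step I st v by rewrite E IH.
have := subset_trans (setSI I (pass_sub I (pass_step I st v) s)) h.
rewrite /pass_step; case: ifP => //= _ /subsetP vI'.
suff -> : (v \in I') = (v \in I) by [].
apply/idP/idP; first exact: subsetP.
by move=> vI; apply: vI'; rewrite !inE eqxx.
Qed.

(** The last bound holds because each recorded element of [I] contributes at least [tau] hyperedges,
    and batches of distinct elements are disjoint, having distinct values at position [j]. It will
    bound the fingerprint. *)
Lemma pass_kept (I : {set V}) (s : seq V) : uniq s ->
  let st := pass I (set0, set0) s in
  [/\ st.1 \subset F, {in st.1, forall x, phi j x \in I /\ phi j x \in s},
      {subset st.2 <= s} & #|st.2 :&: I|%:R * tau <= #|st.1|%:R].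
Proof.
elim/last_ind: s => [|s v IH].
  by move=> _ /=; split=> [|x|x|] /=; rewrite ?sub0set ?in_set0 ?set0I ?cards0 ?mul0r.
rewrite rcons_uniq => /andP[vs /IH]; rewrite /pass -cats1 foldl_cat /=.
set st := foldl _ _ s => -[s1 s2 s3 s4]; rewrite /pass_step.
case: ifP => [tauv|_]; last first.
  split=> // [x /s2[]|x /s3]; rewrite mem_cat => -> //; by move=> ->.
case: ifP => [vI|vI] /=; last first.
  split => // [x /s2[]||].
  - by rewrite mem_cat => ? ->.
  - by move=> x; rewrite !inE mem_cat => /orP[/eqP->|/s3->//]; rewrite inE eqxx orbT.
  - suff -> : (v |: st.2) :&: I = st.2 :&: I by [].
    apply/setP => x; rewrite !inE andb_orl; case: eqP => [->|]; rewrite ?vI //=.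
have dis : [disjoint st.1 & fresh st.1 v].
  rewrite -setI_eq0; apply/eqP/setP => x; rewrite !inE; apply/negP.
  by move=> /and3P[/s2[_ +] _ /andP[/eqP xv _]]; rewrite xv (negbTE vs).
split.
- by rewrite subUset s1; apply/subsetP => x; rewrite !inE => /andP[].
- move=> x; rewrite !inE mem_cat mem_seq1 => /orP[/s2[-> ->]//|/and3P[_ /eqP-> _]].
  by rewrite vI eqxx orbT.
- by move=> x; rewrite !inE mem_cat => /orP[/eqP->|/s3->//]; rewrite inE eqxx orbT.
have -> : (v |: st.2) :&: I = v |: (st.2 :&: I).
  by apply/setP => x; rewrite !inE andb_orl; case: eqP => [->|]; rewrite ?vI.
rewrite cardsU1 !inE (_ : v \in st.2 = false) /=; last by apply: contraNF vs => /s3.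
rewrite cardsU (disjoint_setI0 dis) cards0 subn0 !natrD mulrDl mul1r.
by lra.
Qed.

Lemma fresh_sub (Q Q' : {set X}) (v : V) : Q \subset Q' -> fresh Q' v \subset fresh Q v.
Proof.
move=> QQ; apply/subsetP => x; rewrite !inE => /and3P[-> ->].
exact: unsaturated_sub.
Qed.

Lemma pass_sub1 (I : {set V}) (st : {set X} * {set V}) (s : seq V) :
  st.1 \subset (pass I st s).1.
Proof.
elim: s st => [|v s IH] st //=; apply: subset_trans (IH _).
by rewrite /pass_step; case: ifP => //= _; case: ifP => //= _; exact: subsetUl.
Qed.

(** [fresh] only shrinks while the kept family grows, so what was observed when [v] was examined
    still holds at the end. *)
Lemma pass_fresh (I : {set V}) (st : {set X} * {set V}) (s : seq V) (v : V) : v \in s ->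
  let st' := pass I st s in
  #|fresh st'.1 v|%:R < tau \/ v \in st'.2 /\ (v \in I -> fresh st'.1 v \subset st'.1).
Proof.
elim: s st => [|v0 s IH] st //=; rewrite in_cons => /orP[/eqP->|/IH]; last exact.
have := pass_sub1 I (pass_step I st v0) s; have := pass_sub I (pass_step I st v0) s.
move: (pass I _ s) => st'; rewrite /pass_step.
have [ge|lt] := leP tau #|fresh st.1 v0|%:R => sY sQ; last first.
  by left; apply: le_lt_trans lt; rewrite ler_nat subset_leq_card// fresh_sub.
right; move: sY; rewrite /= subUset sub1set => /andP[-> _]; split=> // vI.
move: sQ; rewrite /= vI subUset => /andP[Q1 Q2].
by apply: subset_trans Q2; exact: fresh_sub.
Qed.

Hypothesis jP : j \notin P.
Variable K : R.
Hypothesis K0 : 0 <= K.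
Hypothesis u0 : 0 < u.
Hypothesis q0 : 0 < q.
Hypothesis degF : forall (T : {set J}) (x : X), T \subset j |: P -> T != set0 ->
  (degree phi F T x)%:R <= K * u * q ^+ #|T|.

(** A batch that meets the class of [x] contains an unsaturated hyperedge, so the degree was still
    below its cap; the batch has a common element at position [j], so it adds at most the codegree
    of [j |: T] in [F]. The result has the form of [degF] with [u * q] for [u] and [1 + K] for [K],
    ready for the next pass. *)
Lemma pass_degree (I : {set V}) (s : seq V) (T : {set J}) (x : X) :
  T \subset P -> T != set0 ->
  (degree phi (pass I (set0, set0) s).1 T x)%:R <= (1 + K) * (u * q) * q ^+ #|T|.
Proof.
move=> TP T0; have jT : j \notin T by apply: contra jP => /(subsetP TP).
set B := (X in _ <= X); pose ok (Q : {set X}) := (degree phi Q T x)%:R <= B.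
have BE : B = u * q ^+ #|T|.+1 + (K * u * q ^+ #|T|) * q by rewrite /B exprS; ring.
have okS st v : ok st.1 -> ok (pass_step I st v).1.
  rewrite /pass_step; case: ifP => //= _; case: ifP => //= _ okst.
  have degU : (degree phi (st.1 :|: fresh st.1 v) T x <=
      degree phi st.1 T x + #|[set y in fresh st.1 v | agree phi T x y]|)%N.
    rewrite /degree; apply: leq_trans (leq_card_setU _ _).
    by apply/subset_leq_card/subsetP => y; rewrite !inE -andb_orl.
  have [E|[y]] := set_0Vmem [set y in fresh st.1 v | agree phi T x y].
    by apply: le_trans okst; rewrite ler_nat (leq_trans degU)// E cards0 addn0.
  rewrite inE => /andP[]; rewrite inE => /and3P[yF /eqP yv /forallP/(_ T)/implyP unsat] xy.
  rewrite /ok (le_trans (y := (degree phi st.1 T x)%:R +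
      #|[set y in fresh st.1 v | agree phi T x y]|%:R)) -?natrD ?ler_nat//.
  rewrite natrD BE lerD//.
    by rewrite (degree_agree _ xy) ltW// unsat// TP.
  have jT0 : j |: T != set0 by apply/set0Pn; exists j; rewrite setU11.
  have := degF y (setUS [set j] TP) jT0; rewrite cardsU1 jT add1n exprSr mulrA.
  apply: le_trans; rewrite ler_nat /degree; apply/subset_leq_card/subsetP => z.
  rewrite !inE => /andP[/and3P[-> /eqP zv _] /agreeP xz] /=.
  apply/agreeP => e; rewrite !inE => /orP[/eqP->|eT]; first by rewrite yv zv.
  by rewrite -(xz e eT) (agreeP _ _ _ _ xy).
have : ok (set0 : {set X}).
  rewrite /ok /degree (_ : [set y in set0 | _] = set0) ?cards0.
    by rewrite /B !mulr_ge0 ?addr_ge0 ?exprn_ge0 ?(ltW u0) ?(ltW q0).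
  by apply/setP => y; rewrite !inE.
rewrite -[set0]/((set0 : {set X}, set0 : {set V}).1).
by elim: s (set0, _) => [|v s IH] st //= okst; apply/IH/okS.
Qed.

(** Double counting for each [T]: a hyperedge saturated at [T] agrees with at least
    [u * q ^+ #|T|.+1] members of [Q], and each member of [Q] agrees with at most
    [K * u * q ^+ #|T|] hyperedges of [F]. *)
Lemma card_saturated (Q : {set X}) : Q \subset F ->
  #|[set x in F | ~~ unsaturated Q x]|%:R <= 2 ^+ #|P| * (#|Q|%:R * (K / q)).
Proof.
move=> QF.
pose A (T : {set J}) := [set x in F | u * q ^+ #|T|.+1 <= (degree phi Q T x)%:R].
pose Ts := [set T in powerset P | T != set0].
have sub : [set x in F | ~~ unsaturated Q x] \subset \bigcup_(T in Ts) A T.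
  apply/subsetP => x; rewrite inE => /andP[xF /forallPn[T]].
  rewrite negb_imply -leNgt => /andP[hT sat]; apply/bigcupP; exists T.
    by rewrite !inE.
  by rewrite inE xF.
have cardA T : T \in Ts -> #|A T|%:R <= #|Q|%:R * (K / q).
  rewrite !inE => /andP[TP T0].
  have uT : 0 < u * q ^+ #|T|.+1 by rewrite mulr_gt0 ?exprn_gt0.
  rewrite -(ler_pM2r uT).
  have -> : #|Q|%:R * (K / q) * (u * q ^+ #|T|.+1) = #|Q|%:R * (K * u * q ^+ #|T|).
    by rewrite exprS; field; rewrite gt_eqF.
  apply: (@le_trans _ _ (\sum_(x in A T) degree phi Q T x)%:R).
    rewrite natr_sum mulr_natl -sumr_const; apply: ler_sum => x.
    by rewrite inE => /andP[].
  rewrite sum_degree_sym natr_sum mulr_natl -sumr_const; apply: ler_sum => y _.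
  apply: le_trans (degF y (subset_trans TP (subsetUr _ _)) T0).
  by rewrite ler_nat degree_sub//; apply/subsetP => x; rewrite inE => /andP[].
apply: (@le_trans _ _ (\sum_(T in Ts) #|A T|)%:R).
  by rewrite ler_nat (leq_trans (subset_leq_card sub))// unstable.card_big_setU.
rewrite natr_sum (le_trans (ler_sum _ cardA))// sumr_const -[leLHS]mulr_natl.
rewrite ler_wpM2r ?mulr_ge0 ?invr_ge0 ?(ltW q0)//.
rewrite -natrX ler_nat -card_powerset; apply/subset_leq_card/subsetP => T.
by rewrite inE => /andP[].
Qed.

(** At the end each hyperedge of [F] lies in a light fresh fibre, is kept, is saturated, or has at
    position [j] a recorded element outside [I]. If the first three classes are small, many recorded
    elements avoid [I]. *)
Lemma pass_count (I C : {set V}) : 0 <= tau -> {in F, forall x, phi j x \in C} ->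
  let st := pass I (set0, set0) (enum C) in
  #|F|%:R <= #|C|%:R * tau + (1 + 2 ^+ #|P| * (K / q)) * #|st.1|%:R +
             #|st.2 :\: I|%:R * (K * u * q).
Proof.
move=> tau0 FC; cbv zeta; set st := pass I _ _.
have QF : st.1 \subset F by have [] := pass_kept I (enum_uniq (mem C)).
pose A1 := [set x in F | (x \in fresh st.1 (phi j x)) && (#|fresh st.1 (phi j x)|%:R < tau)].
pose A2 := [set x in F | phi j x \in st.2 :\: I].
have sub : F \subset A1 :|: st.1 :|: [set x in F | ~~ unsaturated st.1 x] :|: A2.
  apply/subsetP => x xF; have xC : phi j x \in enum C by rewrite mem_enum FC.
  rewrite !inE xF eqxx /=; have [xu|//] := boolP (unsaturated st.1 x); last by rewrite orbT.
  have [->//|[-> hI]] := pass_fresh I (set0, set0) xC.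
  have [/hI/subsetP/(_ x)|_] := boolP (phi j x \in I); last by rewrite !orbT.
  by rewrite !inE xF eqxx xu => /(_ isT) ->; rewrite !orbT.
have cA1 : #|A1|%:R <= #|C|%:R * tau.
  apply: (card_fibres_le (f := phi j)) => [x|v vC]; first by rewrite inE => /andP[/FC].
  have [E|[x]] := set_0Vmem [set x in A1 | phi j x == v]; first by rewrite E cards0.
  rewrite !inE => /andP[/and3P[_ _ /ltW lt] /eqP xv]; rewrite xv in lt.
  apply: le_trans lt; rewrite ler_nat; apply/subset_leq_card/subsetP => y.
  rewrite inE => /andP[+ /eqP yv]; rewrite inE => /and3P[_ + _]; by rewrite yv.
have cA2 : #|A2|%:R <= #|st.2 :\: I|%:R * (K * u * q).
  apply: (card_fibres_le (f := phi j)) => [x|v vC]; first by rewrite inE => /andP[].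
  have [E|[x]] := set_0Vmem [set x in A2 | phi j x == v].
    by rewrite E cards0 !mulr_ge0 ?(ltW u0) ?(ltW q0).
  rewrite inE => /andP[_ /eqP xv].
  have := degF (T := [set j]) x (subsetUl _ _); rewrite -card_gt0 cards1 expr1 => /(_ isT).
  apply: le_trans; rewrite ler_nat; apply/subset_leq_card/subsetP => y.
  rewrite !inE => /andP[/andP[-> _] /eqP yv]; apply/agreeP => e; rewrite inE => /eqP->.
  by rewrite xv yv.
have cU (A B : {set X}) : #|A :|: B|%:R <= #|A|%:R + #|B|%:R :> R.
  by rewrite -natrD ler_nat leq_card_setU.
have cF : #|F|%:R <= #|A1|%:R + #|st.1|%:R + #|[set x in F | ~~ unsaturated st.1 x]|%:R
    + #|A2|%:R :> R.
  apply: le_trans (_ : #|A1 :|: st.1 :|: [set x in F | ~~ unsaturated st.1 x] :|: A2|%:R <= _).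
    by rewrite ler_nat subset_leq_card.
  by do 3![apply: le_trans (cU _ _) _; rewrite lerD2r].
have := card_saturated QF.
by move: cF cA1 cA2; lra.
Qed.
End Pass.

(** * From passes to containers *)

Section Containers.
Context {R : realType}.

Definition inside (X V J : finType) (phi : J -> X -> V) (P : {set J}) (I : {set V}) :
    {set X} :=
  [set x | [forall e in P, phi e x \in I]].

Lemma container_step (s : nat) (c K : R) : 0 < c -> 0 < K ->
  exists alpha L c0 : R, [/\ 0 < alpha, 0 < L & 0 < c0] /\
  forall (X V J : finType) (phi : J -> X -> V) (F : {set X}) (C : {set V}) (P : {set J})
    (u q N : R),
    #|P| = s -> 0 < u -> 0 < q <= 1 -> 0 < N -> #|C|%:R <= N ->
    F \subset inside phi P C ->
    (forall (T : {set J}) (x : X), T \subset P -> T != set0 ->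
      (degree phi F T x)%:R <= K * u * q ^+ #|T|) ->
    c * u * q * N <= #|F|%:R ->
  exists Z : {set V} -> {set V}, forall I : {set V},
    #|F :&: inside phi P I|%:R <= c0 * u * q ^+ s.+1 * N ->
    [/\ Z I \subset C, [disjoint Z I & I], alpha * N <= #|Z I|%:R
      & certified Z I (L * q * N)].
Proof.
elim: s c K => [|s IH] c K c_gt0 K_gt0.
  (* With no position left every hyperedge is inside [I], so the lower bound on [#|F|] contradicts
     the assumption of few. *)
  exists 1, 1, (c / 2); split; first by rewrite !ltr01 divr_gt0.
  move=> X V J phi F C P u q N /eqP; rewrite cards_eq0 => /eqP -> u0 /andP[q0 q1] N0 _ _ _ cF.
  exists (fun=> set0) => I; rewrite (_ : inside phi set0 I = setT); last first.
    by apply/setP => x; rewrite !inE; apply/forallP => e; rewrite inE.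
  rewrite setIT expr1 leNgt (lt_le_trans _ cF)// !ltr_pM2r//.
  by rewrite ltr_pdivrMr// mulr_natr mulr2n ltrDr.
(* In [pass_count], light fibres cost a quarter of [c * u * q * N] by the choice of [tau], and a
   kept family below the level of [c'] costs another quarter with the saturated hyperedges. The
   remaining half forces at least [c / (2 * K) * N] recorded elements outside [I]. *)
pose c' := c / (4 * (1 + 2 ^+ s * K)).
have D0 : 0 < 1 + 2 ^+ s * K by rewrite ltr_pwDl ?mulr_ge0 ?exprn_ge0 ?(ltW K_gt0).
have c'0 : 0 < c' by rewrite divr_gt0 ?mulr_gt0.
have K'0 : 0 < 1 + K by rewrite addr_gt0.
have [alpha' [L' [c0' [[a'0 L'0 c0'0] {}IH]]]] := IH c' (1 + K) c'0 K'0.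
pose alpha := Num.min alpha' (c / (2 * K)).
exists alpha, (4 * (1 + K + c0') / c + L'), c0'; split.
  by rewrite /alpha lt_min a'0 addr_gt0 ?divr_gt0 ?mulr_gt0 ?addr_gt0.
move=> X V J phi F C P u q N cP u0 /andP[q0 q1] N0 CN FC degF cF.
have /card_gt0P[j jP] : (0 < #|P|)%N by rewrite cP.
pose P' := P :\ j.
have jP' : j \notin P' by rewrite !inE eqxx.
have PE : j |: P' = P by rewrite setD1K.
have cP' : #|P'| = s by move: (cardsU1 j P'); rewrite jP' PE cP => -[].
pose tau := c / 4 * u * q.
have tau0 : 0 < tau by rewrite !mulr_gt0 ?divr_gt0.
have inP e x : x \in F -> e \in P -> phi e x \in C.
  by move=> /(subsetP FC); rewrite inE => /forall_inP h /h.
have FCj : {in F, forall x, phi j x \in C} by move=> x /inP; apply.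
pose st I := pass phi F P' j u q tau I (set0, set0) (enum C).
have degF' (T : {set J}) (x : X) : T \subset j |: P' -> T != set0 ->
  (degree phi F T x)%:R <= K * u * q ^+ #|T| by rewrite PE; exact: degF.
have deg' I (T : {set J}) (x : X) :=
  pass_degree tau jP' (ltW K_gt0) u0 q0 degF' I (enum C) (T := T) x.
have count I := pass_count (ltW K_gt0) u0 q0 degF' I (ltW tau0) FCj.
have kept I := pass_kept phi F P' j u q tau I (enum_uniq (mem C)).
have inC' I : (st I).1 \subset inside phi P' C.
  have [/subsetP sF _ _ _] := kept I; apply/subsetP => x /sF xF.
  by rewrite inE; apply/forall_inP => e; rewrite inE => /andP[_ eP]; exact: inP.
(* Chosen for all [Q] before [I] is given, so that the choice depends on [I] only through the kept
   family. *)
have /choice[Z' Z'P] (Q : {set X}) : exists Z : {set V} -> {set V},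
    Q \subset inside phi P' C ->
    (forall (T : {set J}) (x : X), T \subset P' -> T != set0 ->
      (degree phi Q T x)%:R <= (1 + K) * (u * q) * q ^+ #|T|) ->
    c' * (u * q) * q * N <= #|Q|%:R ->
    forall I : {set V}, #|Q :&: inside phi P' I|%:R <= c0' * (u * q) * q ^+ s.+1 * N ->
    [/\ Z I \subset C, [disjoint Z I & I], alpha' * N <= #|Z I|%:R
      & certified Z I (L' * q * N)].
  have [hQ|hQ] := pselect [/\ Q \subset inside phi P' C,
    (forall (T : {set J}) (x : X), T \subset P' -> T != set0 ->
      (degree phi Q T x)%:R <= (1 + K) * (u * q) * q ^+ #|T|) &
    c' * (u * q) * q * N <= #|Q|%:R].
    have [h1 h2 h3] := hQ.
    have [|Z hZ] := IH X V J phi Q C P' (u * q) q N cP' (mulr_gt0 u0 q0) _ N0 CN h1 h2 h3.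
      by rewrite q0.
    by exists Z.
  by exists (fun=> set0) => h1 h2 h3; case: hQ.
pose big (Q : {set X}) := c' * (u * q) * q * N <= #|Q|%:R :> R.
(* The difference is certified along with the state: a set between [(st I).2 :&: I] and [I] yields
   the same state and meets its second component in the same set. *)
pose f I := (st I, (st I).2 :\: I).
pose g (sZ : ({set X} * {set V}) * {set V}) : {set V} -> {set V} :=
  if big sZ.1.1 then Z' sZ.1.1 else fun=> sZ.2.
exists (fun I => g (f I) I) => I few.
have [stF stI stC stcard] := kept I; rewrite -/(st I) in stF stI stC stcard.
(* Kept hyperedges already have their element at position [j] in [I]. *)
have few1 : #|(st I).1 :&: inside phi P' I|%:R <= c0' * u * q ^+ s.+2 * N.
  apply: le_trans few; rewrite ler_nat; apply/subset_leq_card/subsetP => x.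
  rewrite !inE => /andP[xst /forall_inP xI]; rewrite (subsetP stF) //=.
  apply/forall_inP => e eP; have [->|ej] := eqVneq e j; first by have [] := stI x xst.
  by apply: xI; rewrite !inE ej.
have few2 : #|(st I).1 :&: inside phi P' I|%:R <= c0' * (u * q) * q ^+ s.+1 * N.
  by rewrite -[c0' * _ * _]mulrA -[u * q * _]mulrA -exprS [c0' * _]mulrA.
(* If a position remains, its fibres are bounded by [pass_degree]. If none remains there is no
   codegree to use, but then all kept hyperedges are inside [I] and [few1] bounds them. *)
have stle : #|(st I).1|%:R <= (1 + K + c0') * u * q ^+ 2 * N.
  have [P0|[e eP']] := set_0Vmem P'.
    have s0 : s = 0%N by rewrite -cP' P0 cards0.
    have inT : inside phi P' I = setT.
      by apply/setP => x; rewrite P0 !inE; apply/forallP => e; rewrite inE.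
    move: few1; rewrite inT setIT s0 => few1; apply: le_trans few1 _.
    by rewrite !ler_wpM2r ?exprn_ge0 ?(ltW q0) ?(ltW u0) ?(ltW N0)// lerDr ltW.
  have := @card_fibres_le R _ _ (phi e) (st I).1 C ((1 + K) * (u * q) * q).
  move=> /(_ _ _)/le_trans; apply.
  - by move=> x /(subsetP (inC' I)); rewrite inE => /forall_inP; apply.
  - move=> v _; have [->|[x]] := set_0Vmem [set x in (st I).1 | phi e x == v].
      by rewrite cards0 !mulr_ge0 ?(ltW q0) ?(ltW u0) ?(ltW K'0).
    rewrite inE => /andP[_ /eqP xv].
    have := deg' I [set e] x; rewrite sub1set eP' -card_gt0 cards1 expr1 => /(_ isT isT).
    apply: le_trans; rewrite ler_nat; apply/subset_leq_card/subsetP => y.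
    rewrite !inE => /andP[-> /eqP yv]; apply/agreeP => e'; rewrite inE => /eqP->.
    by rewrite xv yv.
  - rewrite [leRHS]mulrC ler_pM//.
      by rewrite !mulr_ge0 ?(ltW q0) ?(ltW u0) ?(ltW K'0).
    rewrite expr2 !mulrA !ler_wpM2r ?(ltW q0) ?(ltW u0)//.
    by rewrite lerDl ltW.
have cert1 : certified f I (4 * (1 + K + c0') / c * q * N).
  exists ((st I).2 :&: I); split; first exact: subsetIr.
    rewrite -(ler_pM2r tau0) (le_trans stcard)// (le_trans stle)//.
    by rewrite le_eqVlt; apply/orP; left; apply/eqP; rewrite /tau; field; rewrite gt_eqF.
  move=> I' sI I'I; have E : st I' = st I by apply: pass_certificate.
  rewrite /f E; congr (_, _); apply/setP => x; rewrite !inE.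
  have [xst|] := boolP (x \in (st I).2); rewrite ?andbF// !andbT; congr (~~ _).
  by apply/idP/idP => [/(subsetP I'I)//|xI]; apply: (subsetP sI); rewrite inE xst.
have cert2 : certified (fun I => g (f I) I) I ((4 * (1 + K + c0') / c + L') * q * N).
  rewrite (mulrDl _ L' q) (mulrDl _ (L' * q) N); apply: certified_dep cert1 _.
  rewrite /g; case: ifP => bg; first by have [] := Z'P _ (inC' I) (deg' I) bg I few2.
  by apply: certified_const; rewrite !mulr_ge0 // ltW.
rewrite /g /f /=; case: ifP => bg.
  have [h1 h2 h3 _] := Z'P _ (inC' I) (deg' I) bg I few2; split=> //.
  by apply: le_trans h3; rewrite ler_wpM2r ?(ltW N0)// ge_min lexx.
split => //.
- by apply/subsetP => x; rewrite inE => /andP[_ /stC]; rewrite mem_enum.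
- by rewrite disjoints_subset; apply/subsetP => x; rewrite !inE => /andP[].
have aK : alpha * K <= c / 2.
  rewrite (@le_trans _ _ (c / (2 * K) * K))//.
    by rewrite ler_wpM2r ?(ltW K_gt0)// /alpha ge_min lexx orbT.
  by rewrite le_eqVlt; apply/orP; left; apply/eqP; field; rewrite gt_eqF.
have Kuq : 0 < K * u * q by rewrite !mulr_gt0.
rewrite -(ler_pM2r Kuq).
have := count I; rewrite -/(st I) cP'.
have : #|C|%:R * tau <= N * tau by rewrite ler_wpM2r // ltW.
have : (1 + 2 ^+ s * (K / q)) * #|(st I).1|%:R <= c / 4 * u * q * N.
  have qD : 1 + 2 ^+ s * (K / q) <= (1 + 2 ^+ s * K) / q.
    by rewrite mulrDl mulrA mul1r lerD2r invf_ge1.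
  apply: le_trans (_ : (1 + 2 ^+ s * K) / q * (c' * (u * q) * q * N) <= _); last first.
    rewrite le_eqVlt; apply/orP; left; apply/eqP; rewrite /c'; field.
    by rewrite !gt_eqF.
  apply: ler_pM => //; last by rewrite ltW// ltNge (negbT bg).
  by rewrite addr_ge0 ?mulr_ge0 ?exprn_ge0 ?divr_ge0 ?invr_ge0 ?ltW.
have : alpha * N * (K * u * q) <= c / 2 * (u * q * N).
  rewrite (_ : alpha * N * (K * u * q) = alpha * K * (u * q * N)); last by ring.
  by rewrite ler_wpM2r// !mulr_ge0 ?ltW.
move: cF; rewrite /tau; cbv zeta; lra.
Qed.

(** As long as the current container is rich, [container_step] removes at least [alpha * N] elements
    of it outside [I]; since it starts with at most [N], this stops within [t] rounds, whose
    certificates add up. *)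
Lemma containers (s : nat) (c K : R) : 0 < c -> 0 < K ->
  exists L c0 : R, [/\ 0 < L & 0 < c0] /\
  forall (X V J : finType) (phi : J -> X -> V) (F : {set X}) (C : {set V}) (P : {set J})
    (u q N : R),
    #|P| = s -> 0 < u -> 0 < q <= 1 -> 0 < N -> #|C|%:R <= N ->
    (forall (T : {set J}) (x : X), T \subset P -> T != set0 ->
      (degree phi F T x)%:R <= K * u * q ^+ #|T|) ->
  exists Phi : {set V} -> {set V}, forall I : {set V}, I \subset C ->
    #|F :&: inside phi P I|%:R <= c0 * u * q ^+ s.+1 * N ->
    [/\ I \subset Phi I, Phi I \subset C,
        #|F :&: inside phi P (Phi I)|%:R < c * u * q * N & certified Phi I (L * q * N)].
Proof.
move=> c_gt0 K_gt0; have [alpha [L [c0 [[a0 L0 c00] step]]]] := container_step s c_gt0 K_gt0.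
pose t := (Num.bound alpha^-1).
have t0 : alpha^-1 < t%:R by apply: archi_boundP; rewrite invr_ge0 ltW.
exists (t%:R * L), c0; split; first by rewrite mulr_gt0// (lt_trans _ t0)// invr_gt0.
move=> X V J phi F C P u q N cP u0 q01 N0 CN degF.
have /andP[q0 q1] := q01.
have : #|C|%:R <= t%:R * (alpha * N).
  rewrite (le_trans CN)// mulrA ler_peMl ?(ltW N0)//.
  by rewrite -ler_pdivrMr// mul1r ltW.
elim: t {t0} C CN => [|t IH] C CN Ct.
  have C0 : C = set0 by apply/eqP; rewrite -cards_eq0 -leqn0 -(ler_nat R) (le_trans Ct)// mul0r.
  (* Richness is not absurd by itself here: for empty [P], [inside phi P set0] is everything.
     [container_step] refutes it by producing a nonempty subset of [set0]. *)
  exists id => I IC few; split => //; last first.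
    exists set0; split; rewrite ?sub0set ?cards0 ?mul0r// => J' _.
    by move: IC; rewrite C0 subset0 => /eqP ->; rewrite subset0 => /eqP.
  rewrite ltNge; apply/negP => big.
  have degFI (T : {set J}) (x : X) : T \subset P -> T != set0 ->
      (degree phi (F :&: inside phi P I) T x)%:R <= K * u * q ^+ #|T|.
    by move=> TP T0; apply: le_trans (degF T x TP T0); rewrite ler_nat degree_sub ?subsetIl.
  have IN : #|I|%:R <= N.
    by rewrite (le_trans _ CN)// ler_nat subset_leq_card.
  have [Z /(_ I)[]] := step X V J phi _ I P u q N cP u0 q01 N0 IN (subsetIr _ _) degFI big.
    by rewrite -setIA setIid.
  rewrite [I](_ : _ = set0); last by apply/eqP; rewrite -subset0 -C0.
  rewrite subset0 => /eqP -> _; rewrite cards0 => + _.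
  by rewrite leNgt mulr_gt0.
have /choice[Phi hPhi] (C' : {set V}) : exists Phi : {set V} -> {set V},
    #|C'|%:R <= N -> #|C'|%:R <= t%:R * (alpha * N) ->
    forall I : {set V}, I \subset C' -> #|F :&: inside phi P I|%:R <= c0 * u * q ^+ s.+1 * N ->
    [/\ I \subset Phi I, Phi I \subset C', #|F :&: inside phi P (Phi I)|%:R < c * u * q * N
      & certified Phi I (t%:R * L * q * N)].
  have [h1|] := boolP (#|C'|%:R <= N); last by exists id.
  have [h2|] := boolP (#|C'|%:R <= t%:R * (alpha * N)); last by exists id.
  by have [Phi hPhi] := IH C' h1 h2; exists Phi.
have [big|small] := leP (c * u * q * N) #|F :&: inside phi P C|%:R; last first.
  exists (fun=> C) => I IC few; split => //.
  by apply: certified_const; rewrite !mulr_ge0// ltW.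
have degFC (T : {set J}) (x : X) : T \subset P -> T != set0 ->
    (degree phi (F :&: inside phi P C) T x)%:R <= K * u * q ^+ #|T|.
  by move=> TP T0; apply: le_trans (degF T x TP T0); rewrite ler_nat degree_sub ?subsetIl.
have [Z hZ] := step X V J phi _ C P u q N cP u0 q01 N0 CN (subsetIr _ _) degFC big.
exists (fun I => Phi (C :\: Z I) I) => I IC few.
have [|ZC ZI cZ certZ] := hZ I.
  apply: le_trans few; rewrite ler_nat subset_leq_card//.
  by apply: setSI; exact: subsetIl.
have cC' : #|C :\: Z I|%:R <= t%:R * (alpha * N).
  rewrite cardsD (setIidPr ZC) natrB ?subset_leq_card//.
  by move: Ct cZ; rewrite -natr1 mulrDl mul1r; lra.
have IC' : I \subset C :\: Z I by rewrite subsetD IC disjoint_sym.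
have C'N : #|C :\: Z I|%:R <= N.
  by rewrite (le_trans _ CN)// ler_nat subset_leq_card// subsetDl.
have [h1 h2 h3 h4] := hPhi _ C'N cC' I IC' few; split => //.
  exact: subset_trans h2 (subsetDl _ _).
rewrite (_ : _ * q * N = L * q * N + t%:R * L * q * N).
  by apply: (certified_dep (g := fun Z I => Phi (C :\: Z) I)) certZ h4.
by rewrite -natr1; ring.
Qed.

End Containers.

(** * Counting lemma for dense graphs *)

Section DenseCounting.
Context {R : realType} {J W : finType}.
Variables (h : rel J) (E : J -> J -> rel W) (d eps eta : R).
Hypothesis h_irr : irreflexive h.
Hypothesis h_sym : symmetric h.
Hypothesis E_sym : forall i j a b, E i j a b = E j i b a.
Hypothesis d01 : 0 < d <= 1.
Hypothesis eta0 : 0 < eta.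
Hypothesis eps0 : 0 < eps.
Hypothesis epsE : 2 * #|J|%:R * eps <= eta.
Hypothesis W0 : (0 < #|W|)%N.

Definition pairs (i j : J) (A B : {set W}) : {set W * W} :=
  [set x | [&& x.1 \in A, x.2 \in B & E i j x.1 x.2]].

Hypothesis reg : forall i j, h i j -> forall A B : {set W},
  eps * #|W|%:R <= #|A|%:R -> eps * #|W|%:R <= #|B|%:R ->
  d * (#|A|%:R * #|B|%:R) <= #|pairs i j A B|%:R.

(** Positions outside [U] are already embedded and frozen at [f0]; in the induction below their
    adjacency constraints are carried by the candidate sets [A]. *)
Definition partial_homs (U : {set J}) (A : J -> {set W}) (f0 : J -> W) :
    {set {ffun J -> W}} :=
  [set f : {ffun J -> W} |
    [forall i, if i \in U then f i \in A i else f i == f0 i] &&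
    [forall i in U, forall j in U, h i j ==> E i j (f i) (f j)]].

Lemma card_low_degree (i j : J) (A B : {set W}) : h i j ->
  eps * #|W|%:R <= #|B|%:R ->
  #|[set x in A | #|[set y in B | E i j x y]|%:R < d * #|B|%:R]|%:R <= eps * #|W|%:R.
Proof.
move=> hij eB; set A' := [set x in A | _]; rewrite leNgt; apply/negP => big.
have A'0 : (0 < #|A'|)%N.
  by rewrite -(ltr_nat R) (le_lt_trans _ big)// mulr_ge0 ?(ltW eps0).
have := reg hij (ltW big) eB; apply/negP; rewrite -ltNge.
have -> : #|pairs i j A' B| = (\sum_(x in A') #|[set y in B | E i j x y]|)%N.
  rewrite (card_fibres (f := fst) (B := A')); last by move=> x; rewrite inE => /and3P[].
  apply: eq_bigr => x xA'; rewrite -[RHS](card_imset _ (can_inj (fun y => erefl : (x, y).2 = y))).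
  apply: eq_card => -[a b]; rewrite !inE /=; apply/idP/imsetP.
    by move=> /andP[/and3P[_ bB Eab] /eqP <-]; exists b; rewrite ?inE ?bB.
  move=> [y]; rewrite !inE => /andP[yB Exy] [-> ->].
  by rewrite yB Exy eqxx !andbT; move: xA'; rewrite inE.
rewrite natr_sum (_ : d * _ = \sum_(x in A') d * #|B|%:R); last first.
  by rewrite sumr_const -[RHS]mulr_natl; ring.
apply: ltr_sum => [|x]; last by rewrite inE => /andP[].
by case/card_gt0P: A'0 => x xA'; apply/hasP; exists x; rewrite ?mem_index_enum.
Qed.

(** Greedy embedding. Each embedded vertex shrinks the relative candidate size [g] by a factor [d],
    so [eta <= d ^+ #|U| * g] is preserved and regularity stays applicable. By [card_low_degree] at
    most [#|J| * eps * #|W|], hence at most half of [eta * #|W|], choices are bad for some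
    neighbour. *)
Lemma card_partial_homs (U : {set J}) (A : J -> {set W}) (f0 : J -> W) (g : R) :
  eta <= d ^+ #|U| * g -> {in U, forall i, g * #|W|%:R <= #|A i|%:R} ->
  (eta / 2 * #|W|%:R) ^+ #|U| <= #|partial_homs U A f0|%:R.
Proof.
have /andP[d0 d1] := d01.
have n0 : 0 < #|W|%:R :> R by rewrite ltr0n.
have [u] := ubnP #|U|; elim: u => // u IH in U A f0 g *.
rewrite ltnS => Uu eg gA.
have [U0|[i iU]] := set_0Vmem U.
  rewrite U0 cards0 expr0 ler1n card_gt0; apply/set0Pn; exists [ffun i => f0 i].
  rewrite inE; apply/andP; split; first by apply/forallP => i; rewrite inE ffunE.
  by apply/forallP => i; rewrite inE.
pose U' := U :\ i.
have cU : #|U| = #|U'|.+1 by rewrite (cardsD1 i) iU.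
have g0 : 0 < g.
  by rewrite -(pmulr_rgt0 _ (exprn_gt0 #|U| d0)) (lt_le_trans eta0).
have etag : eta <= g.
  by rewrite (le_trans eg)// ler_piMl ?(ltW g0)// exprn_ile1// ltW.
have J0 : (0 < #|J|)%N by apply/card_gt0P; exists i.
have epsg : eps <= g.
  rewrite (le_trans _ etag)// (le_trans _ epsE)// ler_peMl ?ltW//.
  by rewrite -natrM ltr1n; case: #|J| J0 => // m _; rewrite mulnS.
pose low j := [set x in A i | #|[set y in A j | E i j x y]|%:R < d * #|A j|%:R].
pose G := A i :\: \bigcup_(j in [set j in U' | h i j]) low j.
have cG : eta / 2 * #|W|%:R <= #|G|%:R.
  have cB : #|\bigcup_(j in [set j in U' | h i j]) low j|%:R <= #|J|%:R * (eps * #|W|%:R).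
    apply: (@le_trans _ _ (\sum_(j in [set j in U' | h i j]) #|low j|)%:R).
      by rewrite ler_nat unstable.card_big_setU.
    apply: (@le_trans _ _ (\sum_(j in [set j in U' | h i j]) eps * #|W|%:R)).
      rewrite natr_sum; apply: ler_sum => j; rewrite !inE => /andP[/andP[ji jU] hij].
      by apply: card_low_degree => //; rewrite (le_trans _ (gA j jU))// ler_wpM2r// ltW.
    rewrite sumr_const -[leLHS]mulr_natl ler_wpM2r ?mulr_ge0 ?(ltW eps0)//.
    by rewrite ler_nat max_card.
  have cD : #|A i|%:R <= #|G|%:R + #|\bigcup_(j in [set j in U' | h i j]) low j|%:R :> R.
    rewrite -natrD ler_nat (leq_trans _ (leq_card_setU _ _))//.
    by apply/subset_leq_card/subsetP => x; rewrite !inE => ->; rewrite andbT orNb.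
  have := gA i iU.
  have : eta * #|W|%:R <= g * #|W|%:R by rewrite ler_wpM2r// ltW.
  have : 2 * #|J|%:R * eps * #|W|%:R <= eta * #|W|%:R by rewrite ler_wpM2r// ltW.
  by move: cB cD; lra.
have sub : [set f in partial_homs U A f0 | f i \in G] \subset partial_homs U A f0.
  by apply/subsetP => f; rewrite inE => /andP[].
apply: (@le_trans _ _ #|[set f in partial_homs U A f0 | f i \in G]|%:R); last first.
  by rewrite ler_nat subset_leq_card.
rewrite (card_fibres (f := fun f : {ffun J -> W} => f i) (B := G)); last first.
  by move=> f; rewrite inE => /andP[].
rewrite cU exprS natr_sum.
apply: (@le_trans _ _ (\sum_(x in G) (eta / 2 * #|W|%:R) ^+ #|U'|)).
  rewrite sumr_const -[leRHS]mulr_natl ler_wpM2r ?exprn_ge0 ?mulr_ge0 ?invr_ge0//.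
  by rewrite ltW.
apply: ler_sum => x xG.
pose Ax j := if h i j then [set y in A j | E i j x y] else A j.
pose fx j := if j == i then x else f0 j.
have xA : x \in A i by move: xG; rewrite inE => /andP[].
apply: (@le_trans _ _ #|partial_homs U' Ax fx|%:R).
  apply: (IH _ _ _ (d * g)).
  - by rewrite -cU.
  - by move: eg; rewrite cU exprSr -mulrA.
  - move=> j jU'; have jU : j \in U by move: jU'; rewrite inE => /andP[].
    have gj := gA j jU; rewrite /Ax; case: ifP => hij; last first.
      by rewrite (le_trans _ gj)// -mulrA ler_piMl// mulr_ge0// ltW.
    apply: (@le_trans _ _ (d * #|A j|%:R)); first by rewrite -mulrA ler_wpM2l// ltW.
    move: xG; rewrite !inE => /andP[/bigcupP xl _]; rewrite leNgt; apply/negP => lt.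
    by apply: xl; exists j; rewrite inE ?jU' ?hij// xA.
rewrite ler_nat; apply/subset_leq_card/subsetP => f.
rewrite inE => /andP[/forallP fA /forall_inP fE].
have fi : f i = x by have := fA i; rewrite !inE eqxx /fx eqxx => /eqP.
have fAj j : j \in U -> j != i -> f j \in Ax j.
  by move=> jU ji; have := fA j; rewrite !inE jU ji.
rewrite inE; apply/andP; split; last by rewrite fi.
rewrite inE fi xG andbT; rewrite inE; apply/andP; split.
  apply/forallP => j; have [->|ji] := eqVneq j i; first by rewrite iU fi.
  case: ifP => jU; last by have := fA j; rewrite !inE jU andbF /fx (negbTE ji).
  by have := fAj j jU ji; rewrite /Ax; case: ifP => // _; rewrite inE => /andP[].
have Ei j : j \in U -> j != i -> h i j -> E i j x (f j).
  by move=> jU ji hij; have := fAj j jU ji; rewrite /Ax hij inE => /andP[].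
apply/forall_inP => j jU; apply/forall_inP => l lU; apply/implyP => hjl.
have [ji|ji] := eqVneq j i; have [li|li] := eqVneq l i.
- by move: hjl; rewrite ji li h_irr.
- by move: hjl; rewrite ji fi; exact: Ei.
- by move: hjl; rewrite li fi E_sym h_sym; exact: Ei.
- have jU' : j \in U' by rewrite !inE ji.
  by move: (fE j jU') => /forall_inP/(_ l); rewrite !inE li lU hjl; apply.
Qed.
End DenseCounting.

(** * Random subgraphs *)

Section RandomSubset.
Context {R : realType}.

Lemma prod_if_const (T : finType) (G B : {set T}) (a : R) : B \subset G ->
  \prod_(e in G) (if e \in B then a else 1) = a ^+ #|B|.
Proof.
move=> BG; rewrite -big_mkcondr /= -prodr_const; apply: eq_bigl => e.
by rewrite andbC; case: (boolP (e \in B)) => //= /(subsetP BG).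
Qed.

Lemma sum_prod_powerset (T : finType) (G : {set T}) (a b : T -> R) :
  \sum_(F in powerset G) \prod_(e in G) (if e \in F then a e else b e) =
  \prod_(e in G) (a e + b e).
Proof.
pose a' e := if e \in G then a e else 0; pose b' e := if e \in G then b e else 1.
have -> : \prod_(e in G) (a e + b e) = \prod_e (a' e + b' e).
  rewrite big_mkcond; apply: eq_bigr => e _; rewrite /a' /b'.
  by case: ifP => //; rewrite add0r.
rewrite bigA_distr [RHS](bigID (mem (powerset G))) /= [X in _ = _ + X]big1 ?addr0.
  apply: eq_bigr => F; rewrite inE => FG.
  rewrite big_mkcond; apply: eq_bigr => e _; rewrite /a' /b'.
  case: ifP => // eG; case: ifP => // eF.
  by rewrite (subsetP FG) in eG.
move=> F; rewrite inE => /subsetPn[e eF eG].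
by rewrite (bigD1 e) //= eF /a' (negbTE eG) mul0r.
Qed.

Variables (V : finType) (G : graph V) (p : R).
Hypothesis p01 : 0 <= p <= 1.

Let weight (F : graph V) : R := \prod_(e in G) (if e \in F then p else 1 - p).

Lemma weight_ge0 (F : graph V) : 0 <= weight F.
Proof.
by have /andP[p0 p1] := p01; apply: prodr_ge0 => e _; case: ifP; rewrite ?subr_ge0.
Qed.

Lemma prob_Gp_compl (A : pred (graph V)) : prob_Gp G p A = 1 - prob_Gp G p (predC A).
Proof.
apply/eqP; rewrite eq_sym subr_eq /prob_Gp -bigID sum_prod_powerset /=.
by rewrite big1// => e _; rewrite addrC subrK.
Qed.

Lemma prob_Gp_union (T : finType) (D : pred T) (A : pred (graph V))
    (B : T -> pred (graph V)) :
  (forall F : graph V, F \subset G -> A F -> exists2 S, D S & B S F) ->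
  prob_Gp G p A <= \sum_(S | D S) prob_Gp G p (B S).
Proof.
move=> AB; rewrite /prob_Gp.
rewrite (exchange_big_dep (mem (powerset G))) /=; last by move=> S F _ /andP[].
rewrite [leRHS](bigID A) /= -[leLHS]addr0; apply: lerD; last first.
  by apply: sumr_ge0 => F _; apply: sumr_ge0 => S _; apply: weight_ge0.
apply: ler_sum => F /andP[FG AF]; have [|S DS BS] := AB F _ AF; first by rewrite inE in FG.
rewrite (bigD1 S) /=; last by rewrite DS FG.
rewrite lerDl; apply: sumr_ge0 => S' _; exact: weight_ge0.
Qed.

(* Exponential moments, with e^(1/2) as the multiplier. *)
Lemma prob_Gp_tail (S W : graph V) (a : R) : S \subset G -> W \subset G ->
  prob_Gp G p (fun F => (S \subset F) && (a <= #|F :&: W|%:R)) <=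
  p ^+ #|S| * expR (p * #|W|%:R + (#|S|%:R - a) / 2).
Proof.
move=> SG WG; have /andP[p0 p1] := p01.
(* The bound [lam <= 2] yields [lam * p + (1 - p) <= 1 + p <= expR p], the factor of an element of
   [W] outside [S]. *)
pose lam : R := expR (1 / 2).
have lam2 : lam <= 2.
  have := expR_ge1Dx (- (1 / 2) : R); rewrite expRN -/lam.
  have lam0 : 0 < lam by exact: expR_gt0.
  by rewrite -[X in _ <= X]mul1r ler_pdivlMr//; lra.
(* Weights of presence and absence: on [S] absence is excluded, on the rest of [W] presence is
   tilted by [lam]. Leaving [S] untilted costs the [#|S|%:R / 2] of the exponent. *)
pose f e := if e \in S then p else if e \in W then lam * p else p.
pose g e : R := if e \in S then 0 else 1 - p.
have f0 e : 0 <= f e.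
  by rewrite /f; case: ifP => // _; case: ifP => // _; rewrite mulr_ge0 ?expR_ge0.
have g0 e : 0 <= g e by rewrite /g; case: ifP => // _; rewrite subr_ge0.
have main : prob_Gp G p (fun F => (S \subset F) && (a <= #|F :&: W|%:R)) <=
    expR ((#|S|%:R - a) / 2) * \prod_(e in G) (f e + g e).
  rewrite -sum_prod_powerset mulr_sumr.
  rewrite [leRHS](bigID (fun F : graph V => (S \subset F) && (a <= #|F :&: W|%:R))) /=.
  rewrite -[leLHS]addr0; apply: lerD; last first.
    apply: sumr_ge0 => F _; rewrite mulr_ge0 ?expR_ge0//.
    by apply: prodr_ge0 => e _; case: ifP.
  apply: ler_sum => F /andP[]; rewrite inE => FG /andP[SF aF].
  have -> : \prod_(e in G) (if e \in F then f e else g e) =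
      weight F * lam ^+ #|F :&: W :\: S|.
    rewrite -(prod_if_const (G := G)); last first.
      by apply/subsetP => e; rewrite !inE => /and3P[_ /(subsetP FG)].
    rewrite -big_split /=; apply: eq_bigr => e eG; rewrite !inE /f /g.
    have [eS|eS] := boolP (e \in S); first by rewrite (subsetP SF)// mulr1.
    case: (boolP (e \in F)) => eF /=; last by rewrite mulr1.
    by case: ifP; rewrite ?mulr1 // mulrC.
  rewrite mulrCA -[leLHS]mulr1 ler_wpM2l ?weight_ge0//.
  rewrite /lam -expRM_natl -expRD -[leLHS]expR0 ler_expR.
  have : #|F :&: W|%:R <= #|F :&: W :\: S|%:R + #|S|%:R :> R.
    rewrite -natrD ler_nat (leq_trans _ (leq_card_setU _ _))//.
    by apply/subset_leq_card/subsetP => e; rewrite !inE => ->; rewrite andbT orNb.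
  by move: aF; lra.
apply: le_trans main _; rewrite expRD mulrA mulrC ler_wpM2r ?expR_ge0//.
rewrite -(prod_if_const p SG) [p * _]mulrC expRM_natl.
rewrite -(prod_if_const _ WG) -big_split /=.
apply: ler_prod => e _; rewrite addr_ge0//= /f /g.
have ep : 1 <= expR p by rewrite -expR0 ler_expR.
case: ifP => _; first by rewrite addr0; case: ifP => _; rewrite ?mulr1// ler_peMr.
case: ifP => _; last by rewrite mulr1 addrC subrK.
rewrite mul1r (le_trans _ (expR_ge1Dx p))//.
have := ler_wpM2r p0 lam2; lra.
Qed.

(** Union bound over the certificates. Counting them needs no binomial coefficients: for
    [#|S|%:R <= m], [p ^+ #|S|] is at most [expR (kappa * m)] times [(expR (- kappa) * p) ^+ #|S|],
    and the latter sums over all subsets of [G] to a product. *)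
Lemma prob_Gp_certificates (A : pred (graph V)) (W : graph V -> graph V)
    (a : graph V -> R) (m kappa M : R) : 0 <= kappa ->
  (forall S, W S \subset G) -> (forall S, p * #|W S|%:R - a S / 2 <= - M) ->
  (forall F : graph V, F \subset G -> A F -> exists S : graph V,
     [/\ S \subset F, #|S|%:R <= m & a S <= #|F :&: W S|%:R]) ->
  prob_Gp G p A <= expR (m / 2 + kappa * m + expR (- kappa) * p * #|G|%:R - M).
Proof.
move=> kappa0 WG WM hA; have /andP[p0 p1] := p01.
pose D (S : graph V) := (S \subset G) && (#|S|%:R <= m).
pose B (S F : graph V) := (S \subset F) && (a S <= #|F :&: W S|%:R).
have AB (F : graph V) : F \subset G -> A F -> exists2 S, D S & B S F.
  move=> FG /(hA F FG)[S [SF Sm aS]]; exists S; last by rewrite /B SF.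
  by rewrite /D Sm (subset_trans SF).
apply: le_trans (prob_Gp_union AB) _.
pose th := expR (- kappa) * p.
have th0 : 0 <= th by rewrite mulr_ge0 ?expR_ge0.
apply: (@le_trans _ _ (\sum_(S in powerset G) th ^+ #|S| * expR (m / 2 + kappa * m - M))).
  rewrite [leRHS](bigID (fun S : graph V => #|S|%:R <= m)) /= -[leLHS]addr0; apply: lerD.
    under [leRHS]eq_bigl do rewrite inE.
    apply: ler_sum => S /andP[SG Sm].
    apply: le_trans (prob_Gp_tail _ SG (WG S)) _.
    rewrite /th exprMn -expRM_natl [expR _ * _]mulrC -mulrA ler_wpM2l ?exprn_ge0//.
    rewrite -expRD ler_expR.
    have := WM S; have := ler_wpM2l kappa0 Sm.
    by move: Sm; lra.
  by apply: sumr_ge0 => S _; rewrite mulr_ge0 ?exprn_ge0 ?expR_ge0.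
rewrite -mulr_suml.
have -> : m / 2 + kappa * m + expR (- kappa) * p * #|G|%:R - M =
   th * #|G|%:R + (m / 2 + kappa * m - M) by rewrite /th; ring.
rewrite [leRHS]expRD ler_wpM2r ?expR_ge0//.
have -> : \sum_(S in powerset G) th ^+ #|S| =
    \sum_(S in powerset G) \prod_(e in G) (if e \in S then th else 1).
  by apply: eq_bigr => S; rewrite inE => SG; rewrite prod_if_const.
rewrite (sum_prod_powerset G (fun=> th) (fun=> 1)) prodr_const mulrC expRM_natl.
rewrite lerXn2r ?nnegrE ?expR_ge0 ?addr_ge0//.
by rewrite addrC expR_ge1Dx.
Qed.
End RandomSubset.

(** * Graphs, density and canonical copies *)

Section Adjacency.
Variables (V : finType) (E : graph V).

Lemma adj_sym (x y : V) : adj E x y = adj E y x.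
Proof. by rewrite /adj setUC. Qed.

Lemma adj_irr (x : V) : is_graph E -> adj E x x = false.
Proof.
move=> /forall_inP gE; apply/negP => /gE.
by rewrite setUid cards1.
Qed.

Lemma card_graph : is_graph E -> (#|E| <= #|V| ^ 2)%N.
Proof.
move=> /forall_inP gE; rewrite -mulnn -card_prod.
apply: leq_trans (leq_imset_card (fun x : V * V => [set x.1; x.2]) predT).
apply/subset_leq_card/subsetP => e /gE/cards2P[x [y [_ ->]]].
by apply/imsetP; exists (x, y).
Qed.

Lemma card_cover_gt2 (T : graph V) : is_graph E -> T \subset E -> (1 < #|T|)%N ->
  (2 < #|cover T|)%N.
Proof.
move=> /forall_inP gE /subsetP TE /card_gt1P[e [f [eT fT ef]]].
have /eqP e2 := gE _ (TE _ eT); have /eqP f2 := gE _ (TE _ fT).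
have efT : e :|: f \subset cover T by rewrite subUset !bigcup_sup.
apply: leq_trans (subset_leq_card efT); rewrite ltnNge; apply: contra ef => le2.
have /eqP eE : e == e :|: f by rewrite eqEcard subsetUl e2.
have /eqP fE : f == e :|: f by rewrite eqEcard subsetUr f2.
by rewrite eE -fE.
Qed.

End Adjacency.

(** * The 2-density as a codegree condition *)

Section Threshold.
Variables (R : realType) (V : finType) (E : graph V).

Lemma m2_ge (T : graph V) : is_graph E -> T \subset E -> (1 < #|T|)%N ->
  (#|T|%:R - 1) / (#|cover T|%:R - 2) <= m2 R E.
Proof.
move=> gE TE T1; have c3 := card_cover_gt2 gE TE T1.
rewrite /m2; case: ifP => [/andP[_ /eqP E1]|_].
  by have := subset_leq_card TE; rewrite E1 leqNgt T1.
apply: ub_le_sup; last first.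
  exists (cover T), T; split=> //; rewrite /is_subgraph TE.
  by apply/forall_inP => e eT; exact: bigcup_sup.
exists #|E|%:R => _ [W [F [/andP[FE _] W3 ->]]].
have W3' : 3 <= #|W|%:R :> R by rewrite (ler_nat R 3).
have FE' : #|F|%:R <= #|E|%:R :> R by rewrite ler_nat subset_leq_card.
have E0 : 0 <= #|E|%:R :> R by [].
rewrite ler_pdivrMr; last by lra.
by nra.
Qed.

Lemma threshold_codegree (T : graph V) (n : nat) (q : R) : is_graph E -> T \subset E ->
  (1 < #|T|)%N -> (0 < n)%N -> threshold R E n <= q ->
  1 <= n%:R ^+ (#|cover T| - 2) * q ^+ #|T|.-1.
Proof.
move=> gE TE T1 n0; have c3 := card_cover_gt2 gE TE T1.
have := m2_ge gE TE T1; set mu := (_ / _) => mu_m2.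
have v2 : #|cover T|%:R - 2 = (#|cover T| - 2)%:R :> R by rewrite natrB// ltnW.
have t1 : #|T|%:R - 1 = #|T|.-1%:R :> R by rewrite -subn1 natrB// ltnW.
have v0 : 0 < (#|cover T| - 2)%:R :> R by rewrite ltr0n subn_gt0.
have t0 : 0 < #|T|.-1%:R :> R by rewrite ltr0n -ltnS prednK// ltnW.
have mu0 : 0 < mu by rewrite /mu v2 t1 divr_gt0.
(* Two edges make the 2-density positive, so the default value of [threshold] does not arise. *)
have m20 : 0 < m2 R E by apply: lt_le_trans mu_m2.
rewrite /threshold gt_eqF// => thr.
have n1 : 1 <= n%:R :> R by rewrite ler1n.
have nq : n%:R `^ (- (1 / mu)) <= q.
  apply: le_trans thr; rewrite ler_powR// lerN2 !div1r lef_pV2 ?posrE//.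
have : (n%:R `^ (- (1 / mu))) ^+ #|T|.-1 <= q ^+ #|T|.-1.
  by rewrite lerXn2r ?nnegrE ?powR_ge0// (le_trans _ nq)// powR_ge0.
rewrite -powR_mulrn ?powR_ge0// -powRrM.
have -> : - (1 / mu) * #|T|.-1%:R = - (#|cover T| - 2)%:R.
  by rewrite /mu v2 t1; field; rewrite !gt_eqF.
rewrite powRN powR_mulrn// => nt.
have nv : 0 < n%:R ^+ (#|cover T| - 2) :> R by rewrite exprn_gt0// ltr0n.
by rewrite -(ler_pdivrMl _ _ nv) mulr1.
Qed.
End Threshold.

(** * The hypergraph of canonical copies *)

Section Copies.
Variables (k n : nat) (H : graph 'I_k) (G : graph (vertex k n)).
Hypothesis gH : is_graph H.

Let copies := canonical_copies H G set0 set0.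
Let image (e : {set 'I_k}) (x : {ffun 'I_k -> vertex k n}) : {set vertex k n} := x @: e.

Lemma canonical_copiesE (H' : graph 'I_k) (C : graph (vertex k n)) : H' \subset H ->
  canonical_copies H G H' C = copies :&: inside image H' C.
Proof.
move=> H'H; apply/setP => x; rewrite !inE -!andbA; congr (_ && (_ && _)).
have -> /= : [forall i, forall j, adj set0 i j ==> adj set0 (x i) (x j)].
  by apply/forallP => i; apply/forallP => j; rewrite /adj inE.
apply/forallP/forall_inP => [h e eH'|h i].
  have /cards2P[i [j [_ ee]]] := forall_inP gH e (subsetP H'H e eH').
  rewrite {}ee in eH' *; rewrite /image imsetU !imset_set1.
  by have /forallP/(_ j)/implyP := h i; apply.
apply/forallP => j; apply/implyP => /h; by rewrite /image imsetU !imset_set1.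
Qed.

(** Images of edges are unordered pairs, but [x i] and [y i] both lie in part [i], which excludes a
    swap of the endpoints. *)
Lemma copies_agree (T : graph 'I_k) (x y : {ffun 'I_k -> vertex k n}) : T \subset H ->
  x \in copies -> y \in copies -> agree image T x y ->
  {in cover T, forall i, x i = y i}.
Proof.
move=> TH; rewrite !inE => /and3P[/forallP xp _ _] /and3P[/forallP yp _ _] /agreeP xy.
move=> i /bigcupP[e eT ie]; have : x i \in y @: e.
  by have := xy e eT; rewrite /image => <-; exact: imset_f.
case/imsetP => j je xij; have := xp i; have := yp j.
by rewrite !inE -xij => /eqP -> /eqP ji; rewrite xij ji.
Qed.

Lemma copies_degree (T : graph 'I_k) (x : {ffun 'I_k -> vertex k n}) : T \subset H ->
  (degree image copies T x <= n ^ (k - #|cover T|))%N.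
Proof.
move=> TH; rewrite /degree.
have [->|[y]] := set_0Vmem [set y in copies | agree image T x y]; first by rewrite cards0.
rewrite inE => /andP[yc xy].
pose sec (z : {ffun 'I_k -> vertex k n}) : {ffun 'I_k -> 'I_n} := [ffun i => (z i).2].
pose fam (i : 'I_k) : pred 'I_n := if i \in cover T then pred1 (y i).2 else predT.
have -> : (n ^ (k - #|cover T|) = #|(family fam : {pred {ffun 'I_k -> 'I_n}})|)%N.
  rewrite card_family foldrE big_map -[enum _]/(enum 'I_k) big_enum /=.
  rewrite (bigID (mem (cover T))) /= big1 ?mul1n; last first.
    by move=> i iT; rewrite /fam iT card1.
  rewrite (eq_bigr (fun=> n)); last by move=> i /negbTE iT; rewrite /fam iT card_ord.
  rewrite prod_nat_const; congr (_ ^ _)%N.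
  by rewrite -[X in (X - _)%N](card_ord k) -(cardC (mem (cover T))) addKn.
rewrite -(card_in_imset (f := sec)); last first.
  move=> z z'; rewrite !inE => /andP[/and3P[/forallP zp _ _] _] /andP[/and3P[/forallP zp' _ _] _].
  move=> /ffunP E; apply/ffunP => i; have := E i; rewrite !ffunE.
  have := zp i; have := zp' i; rewrite !inE.
  by case: (z i) => a b; case: (z' i) => a' b' /= /eqP -> /eqP -> ->.
apply/subset_leq_card/subsetP => _ /imsetP[z + ->]; rewrite inE => /andP[zc xz].
apply/familyP => i; rewrite ffunE /fam; case: ifP => // iT; rewrite inE.
rewrite (@copies_agree T z y) //.
by apply/agreeP => e eT; rewrite -(agreeP _ _ _ _ xz) ?(agreeP _ _ _ _ xy).
Qed.

(** The codegree hypothesis of [containers] with [K = 1] and [u = n ^ (k - 2) / q]. For a single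
    edge the bound holds at any [q]; from two edges on it is [threshold_codegree]. *)
Lemma copies_codegree (R : realType) (q : R) (T : graph 'I_k)
    (x : {ffun 'I_k -> vertex k n}) :
  T \subset H -> T != set0 -> (0 < n)%N -> 0 < q -> threshold R H n <= q ->
  (degree image copies T x)%:R <= n%:R ^+ k / n%:R ^+ 2 / q * q ^+ #|T|.
Proof.
move=> TH T0 n0 q0 thr.
have nR : 0 < n%:R :> R by rewrite ltr0n.
have t0 : (0 < #|T|)%N by rewrite card_gt0.
have vk : (#|cover T| <= k)%N by rewrite -[leqRHS]card_ord max_card.
have v2 : (2 <= #|cover T|)%N.
  case/card_gt0P: t0 => e eT; have /eqP <- := forall_inP gH e (subsetP TH e eT).
  by apply/subset_leq_card/bigcup_sup.
apply: (@le_trans _ _ (n%:R ^+ (k - #|cover T|))); first by rewrite -natrX ler_nat copies_degree.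
have -> : n%:R ^+ k / n%:R ^+ 2 / q * q ^+ #|T| =
    n%:R ^+ (k - #|cover T|) * (n%:R ^+ (#|cover T| - 2) * q ^+ #|T|.-1) :> R.
  have -> : n%:R ^+ k = n%:R ^+ (k - #|cover T|) * n%:R ^+ (#|cover T| - 2) * n%:R ^+ 2 :> R.
    by rewrite -!exprD -addnA subnK// subnK.
  have -> : q ^+ #|T| = q * q ^+ #|T|.-1 by rewrite -exprS prednK.
  by rewrite mulfK ?gt_eqF ?exprn_gt0// -!mulrA [q^-1 * _]mulKf ?gt_eqF.
rewrite ler_peMr ?exprn_ge0 ?ler0n//.
have [T1|T1] := ltnP 1 #|T|; first exact: threshold_codegree thr.
have -> : #|T| = 1%N by apply/eqP; rewrite eqn_leq T1.
by rewrite expr0 mulr1 exprn_ege1// ler1n.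
Qed.
End Copies.

(** * Sparse pairs in a graph with few copies *)

Section SparsePairs.
Variables (R : realType) (k n : nat).

Definition graph_pairs (G : graph (vertex k n)) (i j : 'I_k) (A B : {set 'I_n}) :
    {set 'I_n * 'I_n} :=
  pairs (fun i j a b => adj G (i, a) (j, b)) i j A B.

Lemma lower_regular_pairs (H : graph 'I_k) (d eps : R) (G : graph (vertex k n)) (i j : 'I_k)
    (A B : {set 'I_n}) : 0 < eps -> (0 < n)%N -> Gl H d eps G -> adj H i j ->
  eps * n%:R <= #|A|%:R -> eps * n%:R <= #|B|%:R ->
  d * (#|A|%:R * #|B|%:R) <= #|graph_pairs G i j A B|%:R.
Proof.
move=> eps0 n0 /and3P[_ _ /forallP/(_ i)/forallP/(_ j)/implyP reg] /reg.
have inj (l : 'I_k) : injective (pair l : 'I_n -> vertex k n) by move=> a b [].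
have sub (l : 'I_k) (D : {set 'I_n}) : pair l @: D \subset part n l.
  by apply/subsetP => _ /imsetP[a _ ->]; rewrite inE.
have partE (l : 'I_k) : #|part n l| = n.
  rewrite -[RHS]card_ord -(card_imset _ (inj l)); apply: eq_card => -[a b].
  rewrite inE /=; apply/eqP/imsetP => [->|[c _ [-> _]] //]; by exists b.
move=> /forallP/(_ (pair i @: A))/forallP/(_ (pair j @: B))/implyP + eA eB.
have en : 0 < eps * n%:R by rewrite mulr_gt0// ltr0n.
rewrite /density !sub !partE !card_imset// eA eB => /(_ isT).
rewrite ler_pdivlMr; last by rewrite mulr_gt0// (lt_le_trans en)//.
move=> /le_trans; apply; rewrite ler_nat /edges_between.
have inj2 : injective (fun ab : 'I_n * 'I_n => ((i, ab.1), (j, ab.2))).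
  by move=> [a b] [a' b'] /= [-> ->].
rewrite -[leqRHS](card_imset _ inj2); apply/subset_leq_card/subsetP => -[x y].
rewrite inE /= => /and3P[/imsetP[a aA ->] /imsetP[b bB ->] ab].
by apply/imsetP; exists (a, b); rewrite // inE /= aA bB.
Qed.

Definition edges_of_pairs (i j : 'I_k) (D : {set 'I_n * 'I_n}) : graph (vertex k n) :=
  [set [set (i, ab.1); (j, ab.2)] | ab in D].

Lemma card_edges_of_pairs (i j : 'I_k) (D : {set 'I_n * 'I_n}) : i != j ->
  #|edges_of_pairs i j D| = #|D|.
Proof.
move=> ij; rewrite card_imset// => -[a b] [a' b'] /= /setP E.
have := E (i, a); have := E (j, b); rewrite !inE !xpair_eqE !eqxx eq_sym (negbTE ij) /=.
by rewrite orbF => /esym/eqP -> /esym/eqP ->.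
Qed.

(** Contrapositive of the counting lemma, applied to a mixed relation: pairs of [H'] must be edges
    of [C], the other pairs of [H] only edges of [G], where regularity is given. *)
Lemma sparse_pair (H H' : graph 'I_k) (d d' eps eta : R) (G C : graph (vertex k n)) :
  is_graph H -> H' \subset H -> (0 < n)%N -> 0 < d' -> d' <= 1 -> d' <= d -> 0 < eps ->
  0 < eta -> eta <= d' ^+ k -> 2 * k%:R * eps <= eta ->
  Gl H d eps G -> C \subset G ->
  #|canonical_copies H G H' C|%:R < (eta / 2) ^+ k * n%:R ^+ k ->
  exists i j (A B : {set 'I_n}), [/\ adj H' i j, eps * n%:R <= #|A|%:R,
    eps * n%:R <= #|B|%:R & #|graph_pairs C i j A B|%:R < d' * (#|A|%:R * #|B|%:R)].
Proof.
move=> gH H'H n0 d0 d1 d'd eps0 eta0 etad epse GG CG few.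
apply: contrapT => nosparse.
pose E (i j : 'I_k) (a b : 'I_n) :=
  adj G (i, a) (j, b) && (adj H' i j ==> adj C (i, a) (j, b)).
have Esym i j a b : E i j a b = E j i b a.
  by rewrite /E (adj_sym G) (adj_sym H') (adj_sym C).
have reg i j : adj H i j -> forall A B : {set 'I_n},
    eps * #|'I_n|%:R <= #|A|%:R -> eps * #|'I_n|%:R <= #|B|%:R ->
    d' * (#|A|%:R * #|B|%:R) <= #|pairs E i j A B|%:R.
  rewrite card_ord => Hij A B eA eB.
  have [H'ij|H'ij] := boolP (adj H' i j).
    rewrite leNgt; apply/negP => lt; apply: nosparse; exists i, j, A, B; split=> //.
    apply: le_lt_trans lt; rewrite ler_nat; apply/subset_leq_card/subsetP => -[a b].
    rewrite !inE /E H'ij /= => /and3P[-> -> Cab]; rewrite Cab andbT.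
    exact: (subsetP CG).
  apply: (@le_trans _ _ (d * (#|A|%:R * #|B|%:R))); first by rewrite ler_wpM2r.
  apply: le_trans (lower_regular_pairs eps0 n0 GG Hij eA eB) _.
  rewrite ler_nat; apply/subset_leq_card/subsetP => -[a b].
  by rewrite !inE /E (negbTE H'ij) andbT.
have := @card_partial_homs R _ _ (adj H) E d' eps eta
  (fun i => adj_irr i gH) (adj_sym H) Esym _ eta0 eps0 _ _ reg setT (fun=> setT)
  (fun=> Ordinal n0) 1.
rewrite d0 d1 cardsT !card_ord mulr1 => /(_ isT epse n0 etad).
move=> /(_ ltac:(by move=> i _; rewrite mul1r cardsT card_ord)).
apply/negP; rewrite -ltNge exprMn; apply: le_lt_trans few; rewrite ler_nat.
pose lift (f : {ffun 'I_k -> 'I_n}) : {ffun 'I_k -> vertex k n} := [ffun i => (i, f i)].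
have inj : injective lift.
  by move=> f g /ffunP fg; apply/ffunP => i; have := fg i; rewrite !ffunE => -[].
rewrite -(card_imset _ inj); apply/subset_leq_card/subsetP => _ /imsetP[f + ->].
rewrite inE => /andP[_ /forall_inP fE].
have fE' i j : adj H i j -> E i j (f i) (f j).
  by move=> Hij; have /forall_inP/(_ j) := fE i (in_setT i); rewrite inE Hij => /(_ isT).
rewrite inE; apply/and3P; split; apply/forallP => i; first by rewrite inE ffunE.
  by apply/forallP => j; apply/implyP => /fE'/andP[]; rewrite !ffunE.
apply/forallP => j; apply/implyP => H'ij; rewrite !ffunE.
have /fE'/andP[_] : adj H i j by exact: (subsetP H'H).
by rewrite H'ij.
Qed.
End SparsePairs.

Lemma prob_Gp_eq1 (R : realType) (V : finType) (G : graph V) (p : R) (A : pred (graph V)) :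
  0 <= p <= 1 -> (forall F, A F) -> prob_Gp G p A = 1.
Proof.
move=> p01 hA; rewrite prob_Gp_compl [X in _ - X]big1 ?subr0// => F /andP[_].
by rewrite /= hA.
Qed.

(* [Wa] consists of the edges of a sparse pair of the container [C] and of a lower bound for the
   number of them in a lower-regular subgraph of [C]; junk values when [C] is not a container. *)
Lemma sparse_test_set (R : realType) (k n : nat) (H H' : graph 'I_k)
    (G C : graph (vertex k n)) (d d' eps eta p : R) :
  is_graph H -> H' \subset H -> (0 < n)%N -> 0 < d' -> d' <= 1 -> d' <= d / 4 -> 0 < eps ->
  0 < eta -> eta <= d' ^+ k -> 2 * k%:R * eps <= eta -> 0 <= p ->
  Gl H d eps G ->
  exists Wa : graph (vertex k n) * R, [/\ Wa.1 \subset G,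
    p * #|Wa.1|%:R - Wa.2 / 2 <= - (d * eps ^+ 2 / 4 * p * n%:R ^+ 2) &
    C \subset G -> #|canonical_copies H G H' C|%:R < (eta / 2) ^+ k * n%:R ^+ k ->
    forall G' : graph (vertex k n), G' \subset C -> Gl H (d * p) eps G' ->
      Wa.2 <= #|G' :&: Wa.1|%:R].
Proof.
move=> gH H'H n0 d'0 d'1 d'd eps0 eta0 etad epse p0 GG.
pose M := d * eps ^+ 2 / 4 * p * n%:R ^+ 2.
have [[CG few]|nh] := pselect (C \subset G /\
    #|canonical_copies H G H' C|%:R < (eta / 2) ^+ k * n%:R ^+ k); last first.
  exists (set0, 2 * M); split; rewrite ?sub0set//=; last by move=> ? ?; case: nh.
  by rewrite cards0; rewrite -/M; lra.
have d'd1 : d' <= d by lra.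
have [i [j [A [B [H'ij eA eB sparse]]]]] :=
  sparse_pair gH H'H n0 d'0 d'1 d'd1 eps0 eta0 etad epse GG CG few.
have Hij : adj H i j by exact: (subsetP H'H).
have ij : i != j by apply: contraTneq Hij => ->; rewrite adj_irr.
have sub (G' C' : graph (vertex k n)) : G' \subset C' ->
    edges_of_pairs i j (graph_pairs G' i j A B) \subset C' .
  move=> G'C'; apply/subsetP => _ /imsetP[[a b] + ->].
  by rewrite inE => /and3P[_ _ /(subsetP G'C')].
(* Write [a] for the second component. Density below [d / 4] gives [p * #|W| <= a / 4] for the first
   component [W], so subtracting [a / 2] leaves at most [- a / 4], and the sizes of [A] and [B] give
   the factor [eps ^+ 2]. *)
exists (edges_of_pairs i j (graph_pairs C i j A B), d * p * (#|A|%:R * #|B|%:R)).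
split => /=; first exact: subset_trans (sub _ _ (subxx C)) CG.
  rewrite card_edges_of_pairs//.
  have en : 0 <= eps * n%:R by rewrite mulr_ge0// ltW.
  have AB : (eps * n%:R) * (eps * n%:R) <= #|A|%:R * #|B|%:R by exact: ler_pM.
  have h1 := ler_wpM2l p0 (ltW sparse).
  have AB0 : 0 <= p * (#|A|%:R * #|B|%:R) by rewrite !mulr_ge0.
  have h2 := ler_wpM2r AB0 d'd.
  have dp : 0 <= d * p by rewrite mulr_ge0//; lra.
  have h3 := ler_wpM2l dp AB.
  by move: h1 h2 h3; rewrite !expr2; lra.
move=> _ _ G' G'C GG'.
apply: le_trans (lower_regular_pairs eps0 n0 GG' Hij eA eB) _.
rewrite ler_nat -(card_edges_of_pairs _ ij); apply/subset_leq_card.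
rewrite subsetI sub//; apply: imsetS; apply/subsetP => -[a b].
by rewrite !inE => /and3P[-> -> /(subsetP G'C)].
Qed.

Theorem theorem2p1 (R : realType) (k : nat) (H : graph 'I_k) (hH : is_graph H)
    (H' : graph 'I_k) (hH' : H' \subset H) (d : R) (hd : 0 < d) :
  exists (eps xi b C : R) (n0 : nat),
    [/\ 0 < eps, 0 < xi, 0 < b & 0 < C] /\
    forall (n : nat) (p : R), (n0 <= n)%N -> 0 <= p <= 1 ->
      C * threshold R H n <= p ->
      forall G : graph (vertex k n), Gl H d eps G ->
        1 - expR (- (b * p * n%:R ^+ 2)) <=
        prob_Gp G p (fun Gp : graph (vertex k n) =>
          [forall G' : graph (vertex k n),
            (G' \subset Gp) && Gl H (d * p) eps G' ==>
            (xi * p ^+ #|H'| * n%:R ^+ k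
               <= #|canonical_copies H G H' G'|%:R)]).
Proof.
(* [d] may exceed 1, while the counting lemma wants a density at most 1. *)
pose d' := Num.min d 1 / 4.
have d'0 : 0 < d' by rewrite divr_gt0// lt_min hd ltr01.
have d'1 : d' <= 1.
  have : Num.min d 1 <= 1 by rewrite ge_min lexx orbT.
  by rewrite /d'; lra.
have d'd : d' <= d / 4 by rewrite ler_wpM2r// ge_min lexx.
pose eta := d' ^+ k.
have eta0 : 0 < eta by rewrite exprn_gt0.
pose eps := eta / (2 * k.+1%:R).
have eps0 : 0 < eps by rewrite divr_gt0// mulr_gt0.
have epse : 2 * k%:R * eps <= eta.
  rewrite /eps mulrA ler_pdivrMr ?mulr_gt0// mulrC ler_wpM2l ?(ltW eta0)//.
  by rewrite ler_wpM2l// ler_nat.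
(* [kk * n ^ 2] bounds the number of edges of [G]; the added 1, like [k.+1] in [eps], covers
   [k = 0]. *)
pose kk : R := k%:R ^+ 2 + 1.
have kk0 : 0 < kk by rewrite ltr_wpDl ?exprn_ge0.
pose xi' := (eta / 2) ^+ k.
have xi'0 : 0 < xi' by rewrite exprn_gt0// divr_gt0.
have [L [c0 [[L0 c00] cont]]] := @containers R #|H'| (xi' / kk) 1 (divr_gt0 xi'0 kk0) ltr01.
pose mu := d * eps ^+ 2 / 4.
have mu0 : 0 < mu by rewrite divr_gt0// mulr_gt0// exprn_gt0.
(* Since [1 + kappa <= expR kappa], this makes [expR (- kappa) * kk] at most [mu / 4]. *)
pose kappa := 4 * kk / mu.
have kappa0 : 0 < kappa by rewrite divr_gt0// mulr_gt0.
pose Y := 4 * L * kk * (1 / 2 + kappa).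
have Y0 : 0 < Y by rewrite !mulr_gt0// addr_gt0.
(* Gives both [delta <= 1] and [delta * Y <= mu]; by the choice of [Y] the latter says that the
   fingerprint terms of the exponent are at most [mu / 4 * (p * n ^ 2)]. *)
pose delta := mu / (Y + mu).
have delta0 : 0 < delta by rewrite divr_gt0// addr_gt0.
have delta1 : delta <= 1 by rewrite ler_pdivrMr ?addr_gt0// mul1r lerDr ltW.
have deltaY : delta * Y <= mu.
  rewrite /delta mulrAC ler_pdivrMr ?addr_gt0// ler_wpM2l ?(ltW mu0)//.
  by rewrite lerDl ltW.
pose xi := Num.min xi' (c0 * kk * delta ^+ #|H'|).
have xi0 : 0 < xi by rewrite lt_min xi'0 !mulr_gt0// exprn_gt0.
exists eps, xi, (mu / 2), delta^-1, 1%N; split.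
  by split=> //; [rewrite divr_gt0 | rewrite invr_gt0].
move=> n p n0 p01 thr G GG; have /andP[p0 p1] := p01.
have nR : 0 < n%:R :> R by rewrite ltr0n.
(* Containers need [q > 0], yet [p = 0] is allowed when the threshold vanishes. Then the claim is
   trivial unless [H'] is empty, where [p ^+ 0 = 1]; few copies would yield a sparse pair of [H'],
   which has none. *)
have [p_eq0|p_neq0] := eqVneq p 0.
  rewrite prob_Gp_eq1// ?gerBl ?expR_ge0// => F; apply/forallP => G'.
  apply/implyP => _; have [H'0|H'0] := eqVneq H' set0; last first.
    by rewrite p_eq0 expr0n cards_eq0 (negbTE H'0) mulr0 mul0r.
  rewrite H'0 cards0 expr0 mulr1 leNgt; apply/negP => lt.
  have d'd1 : d' <= d by lra.
  have [] := @sparse_pair R k n H H' d d' eps eta G set0 hH hH' n0 d'0 d'1 d'd1 eps0 eta0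
    (lexx _) epse GG (sub0set _).
    apply: le_lt_trans (lt_le_trans lt _); last first.
      by rewrite ler_wpM2r ?exprn_ge0// ge_min lexx.
    rewrite ler_nat H'0; apply/subset_leq_card/subsetP => v; rewrite !inE.
    move=> /and3P[-> -> _] /=; apply/forallP => i; apply/forallP => j.
    by rewrite /adj in_set0.
  by move=> i [j [A [B []]]]; rewrite H'0 /adj inE.
have pp : 0 < p by rewrite lt_neqAle eq_sym p_neq0.
pose q := delta * p.
have q0 : 0 < q by rewrite mulr_gt0.
have q1 : q <= 1 by rewrite mulr_ile1// ltW.
have thrq : threshold R H n <= q by rewrite -ler_pdivrMl.
pose D : R := n%:R ^+ k / n%:R ^+ 2.
have D0 : 0 < D by rewrite divr_gt0 ?exprn_gt0.
pose N := kk * n%:R ^+ 2.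
have N0 : 0 < N by rewrite mulr_gt0 ?exprn_gt0.
have GN : #|G|%:R <= N.
  have /and3P[gG _ _] := GG.
  apply: (@le_trans _ _ (#|{: vertex k n}| ^ 2)%:R); first by rewrite ler_nat card_graph.
  rewrite card_prod !card_ord natrX natrM exprMn /N ler_wpM2r ?exprn_ge0//.
  by rewrite /kk lerDl.
pose copies := canonical_copies H G set0 set0.
pose image (e : {set 'I_k}) (x : {ffun 'I_k -> vertex k n}) : {set vertex k n} := x @: e.
have degC (T : graph 'I_k) (x : {ffun 'I_k -> vertex k n}) : T \subset H' -> T != set0 ->
    (degree image copies T x)%:R <= 1 * (D / q) * q ^+ #|T|.
  move=> TH' T0; rewrite mul1r; apply: copies_codegree => //.
  exact: subset_trans hH'.
have q01 : 0 < q <= 1 by rewrite q0.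
(* With [u = D / q], [id1] turns the assumption of few hyperedges into a bound of order
   [q ^+ #|H'| * n ^ k], and [id2] turns the richness level of a container into [xi' * n ^ k]. *)
have id1 (a b c x y w : R) : b != 0 -> x != 0 ->
    c * (a / b / x) * (x * y) * (w * b) = c * w * y * a.
  by move=> b0 x0; field; rewrite b0 x0.
have id2 (a b c x w : R) : b != 0 -> x != 0 -> w != 0 ->
    c / w * (a / b / x) * x * (w * b) = c * a.
  by move=> b0 x0 w0; field; rewrite b0 x0.
have [Phi PhiP] := cont _ _ _ image copies G H' (D / q) q N erefl (divr_gt0 D0 q0) q01 N0 GN degC.
have /choice[Wa WaP] (C : graph (vertex k n)) :=
  @sparse_test_set R k n H H' G C d d' eps eta p hH hH' n0 d'0 d'1 d'd eps0 eta0 (lexx _) epse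
    p0 GG.
rewrite prob_Gp_compl// lerD2l lerN2.
pose m := L * q * N.
apply: le_trans (@prob_Gp_certificates R _ G p p01 _ (fun S => (Wa (Phi S)).1)
  (fun S => (Wa (Phi S)).2) m kappa (mu * p * n%:R ^+ 2) (ltW kappa0) _ _ _) _.
- by move=> S; have [] := WaP (Phi S).
- by move=> S; have [] := WaP (Phi S).
- move=> F FG /forallPn[G']; rewrite negb_imply -ltNge => /andP[/andP[G'F GG'] few].
  have G'G : G' \subset G by exact: subset_trans FG.
  have few' : #|copies :&: inside image H' G'|%:R <= c0 * (D / q) * q ^+ #|H'|.+1 * N.
    rewrite -canonical_copiesE// (le_trans (ltW few))//.
    have -> : c0 * (D / q) * q ^+ #|H'|.+1 * N =
        c0 * kk * delta ^+ #|H'| * p ^+ #|H'| * n%:R ^+ k.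
      rewrite exprS id1 ?gt_eqF ?exprn_gt0//.
      by rewrite exprMn !mulrA.
    by rewrite !ler_wpM2r ?exprn_ge0// ge_min lexx orbT.
  have [G'Phi PhiG PhiFew [S [SG' Sm SPhi]]] := PhiP G' G'G few'.
  exists S; split=> //; first exact: subset_trans G'F.
  have -> : Phi S = Phi G' by apply: SPhi.
  have [_ _ WaC] := WaP (Phi G').
  apply: le_trans (WaC PhiG _ G' G'Phi GG') _; last by rewrite ler_nat subset_leq_card// setSI.
  rewrite canonical_copiesE//; apply: lt_le_trans PhiFew _.
  by rewrite id2 ?gt_eqF ?exprn_gt0.
rewrite ler_expR.
pose z := p * n%:R ^+ 2.
have z0 : 0 <= z by rewrite mulr_ge0.
(* Fingerprint terms and entropy term take [mu / 4] each out of the gain [mu], which leaves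
   [b = mu / 2]. *)
have hm : m / 2 + kappa * m <= mu / 4 * z.
  have := ler_wpM2r z0 deltaY.
  rewrite /m /q /N /Y /z; lra.
have hG : expR (- kappa) * p * #|G|%:R <= mu / 4 * z.
  have eG : expR (- kappa) * kk <= mu / 4.
    rewrite expRN mulrC ler_pdivrMr ?expR_gt0//.
    apply: (@le_trans _ _ (mu / 4 * (1 + kappa))); last first.
      by rewrite ler_wpM2l ?expR_ge1Dx// divr_ge0 ?ltW.
    rewrite mulrDr mulr1 (_ : mu / 4 * kappa = kk); first by rewrite lerDr divr_ge0 ?ltW.
    by rewrite /kappa; field; rewrite gt_eqF.
  apply: (@le_trans _ _ (expR (- kappa) * p * N)).
    by rewrite ler_wpM2l// mulr_ge0 ?expR_ge0.
  have := ler_wpM2r z0 eG.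
  rewrite /N /z; lra.
by move: hm hG; rewrite /z; lra.
Qed.
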